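(* Let $\phi:\mathbb{R}^n\to\mathbb{R}$ be twice continuously differentiable with $L_2$-Lipschitz Hessian, and bounded below on $\mathbb{R}^n$ by a scalar $\hat\phi$. Run Algorithm 2 (described in the context) with the bounded-noise zeroth-order oracle with constant $\epsilon_f\ge0$, with the first- and second-order oracles with constants $\epsilon_g,\kappa_{\rm eg},\epsilon_H,\kappa_{\rm eh}\ge0$, $\epsilon_g,\epsilon_H\le1$, and reliabilities $p_1,p_2$, with $\|H_k\|\le\kappa_{\rm bhm}$ for all $k$, and with $r\ge2\epsilon_f+\epsilon_g^{3/2}$. Let $p_{12}=p_1p_2>1/2$, let $C_8$ and the optimality measure $\beta$ be as defined in the context, and let $$\sqrt[3]{\frac{4\epsilon_f+2r}{C_8\gamma^3(2p_{12}-1)}}<\epsilon'\le1 .$$ Then $$\mathbb{P}\Big\{\min_{0\le k\le T-1}\beta(X_k)\le\epsilon'\Big\}\ge1-\exp\Big(-\frac{(1-\hat p_{12}/p_{12})^2}{2}T\Big)$$ for every $\hat p_{12}\in\Big(\frac12+\frac{2\epsilon_f+r}{C_8(\gamma\epsilon')^3},\,p_{12}\Big]$ and every positive integer $$T\ge\Big(\hat p_{12}-\frac12-\frac{2\epsilon_f+r}{C_8(\gamma\epsilon')^3}\Big)^{-1}\Big[\frac{\phi(x_0)-\hat\phi}{C_8(\gamma\epsilon')^3}+\frac12\log_\gamma\Big(\min\Big\{\frac{\epsilon'}{\delta_0},\frac{\delta_0}{\beta(x_0)}\Big\}\Big)+\frac12\Big],$$ where $\delta_0/\beta(x_0)$ is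 read as $+\infty$ if $\beta(x_0)\le0$.
   Context: Notation: $\|\cdot\|$ is the Euclidean norm of vectors and the spectral norm of matrices; $\langle\cdot,\cdot\rangle$ is the sum of entrywise products; $\lambda_{\min}$ is the smallest eigenvalue of a symmetric matrix; $\log_\gamma$ is the logarithm to base $\gamma\in(0,1)$. Bounded-noise zeroth-order oracle: given $x$ it returns a (possibly random or adversarial) value $f(x,\xi^{(0)})$ with $|f(x,\xi^{(0)})-\phi(x)|\le\epsilon_f$ for all realizations. First-order oracle: given $\delta^{(1)}>0$, $p_1\in[1/2,1]$, $x\in\mathbb{R}^n$, it returns a random vector $g(x,\xi^{(1)})$ with $\mathbb{P}\{\|g(x,\xi^{(1)})-\nabla\phi(x)\|\le\epsilon_g+\kappa_{\rm eg}\delta^{(1)}\}\ge p_1$. Second-order oracle: given $\delta^{(2)}>0$, $p_2\in[1/2,1]$, $x\in\mathbb{R}^n$, it returns a random symmetric matrix $H(x,\xi^{(2)})$ with $\mathbb{P}\{\|H(x,\xi^{(2)})-\nabla^2\phi(x)\|\le\epsilon_H+\kappa_{\rm eh}\delta^{(2)}\}\ge p_2$. The constants $\epsilon_g,\kappa_{\rm eg},\epsilon_H,\kappa_{\rm eh}\ge0$ are intrinsic to the oracles. Algorithm 2. Inputs: $x_0\in\mathbb{R}^n$, $\delta_0>0$, $\eta_1\in(0,1)$, $\eta_2>0$, $\gamma\in(0,1)$, $r>0$, $p_1,p_2$; constants $\kappa_{\rm fod}\in(0,1]$, $\kappa_{\rm bhm}>0$. For $k=0,1,2,\dots$: (1)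 Obtain $g_k$ from the first-order oracle with input $(\delta_k^2,p_1,x_k)$ and $H_k$ from the second-order oracle with input $(\delta_k,p_2,x_k)$; put $m_k(x_k+s)=\phi(x_k)+\langle g_k,s\rangle+\frac12\langle H_ks,s\rangle$. (2) Compute $s_k$ with $\|s_k\|\le\delta_k$ and $m_k(x_k)-m_k(x_k+s_k)\ge\frac{\kappa_{\rm fod}}{2}\max\{\|g_k\|\min\{\|g_k\|/\|H_k\|,\delta_k\},\,-\lambda_{\min}(H_k)\delta_k^2\}$ (with $\|g_k\|/\|H_k\|=+\infty$ if $H_k=0$). (3) Obtain $f_k$ and $f_k^+$ from the zeroth-order oracle at $x_k$ and $x_k+s_k$, and set $\rho_k=\frac{f_k-f_k^++r}{m_k(x_k)-m_k(x_k+s_k)}$. (4) Let $\beta_k^m=\max\{\|g_k\|,-\lambda_{\min}(H_k)\}$. If $\rho_k\ge\eta_1$: set $x_{k+1}=x_k+s_k$ and $\delta_{k+1}=\gamma^{-1}\delta_k$ if $\beta_k^m\ge\eta_2\delta_k$, $\delta_{k+1}=\gamma\delta_k$ if $\beta_k^m<\eta_2\delta_k$. Otherwise set $x_{k+1}=x_k$, $\delta_{k+1}=\gamma\delta_k$. If $m_k(x_k)=m_k(x_k+s_k)$, the step is rejected (treated as $\rho_k<\eta_1$). Stochastic process: $X_k,\Delta_k$ denote the random iterates and radii with realizations $x_k,\delta_k$. Let $\mathcal{F}_{k-1}$ be the $\sigma$-algebra generated by all oracle randomness in iterations $0,\dots,k-1$ (so $X_k,\Delta_k$ are $\mathcal{F}_{k-1}$-measurable).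 The oracle guarantees hold conditionally on the past, jointly in the sense that, conditionally on $\mathcal{F}_{k-1}$, the event that both $\|H_k-\nabla^2\phi(X_k)\|\le\kappa_{\rm eh}\Delta_k+\epsilon_H$ and $\|g_k-\nabla\phi(X_k)\|\le\kappa_{\rm eg}\Delta_k^2+\epsilon_g$ hold has probability at least $p_{12}=p_1p_2$. Optimality measure: $\beta(x)=\max\{C_4\|\nabla\phi(x)\|-C_5\epsilon_g,\ -C_6\lambda_{\min}(\nabla^2\phi(x))-C_7\epsilon_H\}$, where, with $D=L_2/3+2\kappa_{\rm eg}+\kappa_{\rm eh}$, $$C_4=\min\Big\{\tfrac{1}{\kappa_{\rm bhm}+\kappa_{\rm eg}},\tfrac{(1-\eta_1)\kappa_{\rm fod}}{D+3+(1-\eta_1)\kappa_{\rm fod}\kappa_{\rm eg}},\tfrac{1}{\kappa_{\rm eg}+\eta_2}\Big\},\quad C_5=\max\Big\{\tfrac{1}{\kappa_{\rm bhm}+\kappa_{\rm eg}},\tfrac{(1-\eta_1)\kappa_{\rm fod}}{D+3+(1-\eta_1)\kappa_{\rm fod}\kappa_{\rm eg}},\tfrac{1}{\kappa_{\rm eg}+\eta_2}\Big\},$$ $$C_6=\min\Big\{\tfrac{(1-\eta_1)\kappa_{\rm fod}}{D+2+(1-\eta_1)\kappa_{\rm fod}\kappa_{\rm eh}},\tfrac{1}{\kappa_{\rm eh}+\eta_2}\Big\},\quad C_7=\max\Big\{\tfrac{(1-\eta_1)\kappa_{\rm fod}+1}{D+2+(1-\eta_1)\kappa_{\rm fod}\kappa_{\rm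 eh}},\tfrac{1}{\kappa_{\rm eh}+\eta_2}\Big\}.$$ Also $C_8=\frac{\eta_1\eta_2\kappa_{\rm fod}}{2}\min\{\eta_2/\kappa_{\rm bhm},1\}$. *)

(* Defs.v *)
From HB Require Import structures.
From mathcomp Require Import all_boot all_order all_algebra.
From mathcomp Require Import all_classical all_reals all_analysis.
Set Implicit Arguments.
Unset Strict Implicit.
Unset Printing Implicit Defensive.
Import Order.TTheory GRing.Theory Num.Theory.
Import numFieldNormedType.Exports.
Local Open Scope classical_set_scope.
Local Open Scope ring_scope.

(* Vectors of R^n are row vectors.  The library norm `|_| on matrices is the
   sup norm, so the Euclidean and spectral norms are defined here; the topology
   and the notion of differentiability are the same for all norms. *)
Section linear_algebra.
Context {R : realType} {n : nat}.
Implicit Types (u v : 'rV[R]_n) (A : 'M[R]_n).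

Definition dot u v : R := \sum_(i < n) u 0 i * v 0 i.

Definition enorm v : R := Num.sqrt (dot v v).

Definition specnorm A : R :=
  sup [set enorm (v *m A) | v in [set v | enorm v <= 1]].

(* For a symmetric A and 0 < n the set is finite and nonempty, so the infimum is
   a minimum. *)
Definition lambda_min A : R := inf [set a | eigenvalue A a].

End linear_algebra.

Section smoothness.
Context {R : realType} {n : nat}.
Variable phi : 'rV[R]_n -> R.

Definition grad (x : 'rV[R]_n) : 'rV[R]_n :=
  \row_(i < n) 'D_(delta_mx 0 i) phi x.

Definition hess (x : 'rV[R]_n) : 'M[R]_n := 'J grad x.

Definition twice_continuously_differentiable : Prop :=
  [/\ forall x, differentiable phi x,
      forall x, differentiable grad x &
      continuous hess].

Definition lipschitz_hessian (L : R) : Prop :=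
  forall x y, specnorm (hess x - hess y) <= L * enorm (x - y).

End smoothness.

Section conditional_probability.
Context {R : realType} {d : measure_display} {Omega : measurableType d}.

(* Measurability with respect to a system of events G. *)
Definition adapted {d' : measure_display} {E : measurableType d'}
    (G : set_system Omega) (Y : Omega -> E) : Prop :=
  preimage_set_system setT Y measurable `<=` G.

Definition mx_adapted {m n : nat} (G : set_system Omega)
    (Y : Omega -> 'M[R]_(m, n)) : Prop :=
  forall i j, adapted G (fun w => Y w i j).

(* Y is a version of P(A | G). *)
Definition is_cond_prob (P : probability Omega R) (G : set_system Omega)
    (A : set Omega) (Y : Omega -> R) : Prop :=
  [/\ adapted G Y,
      P.-integrable setT (EFin \o Y) &
      forall B, G B -> (\int[P]_(w in B) (Y w)%:E = P (A `&` B))%E].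

Definition cond_prob_ge (P : probability Omega R) (G : set_system Omega)
    (A : set Omega) (p : R) : Prop :=
  exists2 Y, is_cond_prob P G A Y & {ae P, forall w, p <= Y w}.

End conditional_probability.

(* All scalars attached to the oracles, to phi (L2) and to the algorithm, except
   the starting point and the initial radius. *)
Record params (R : realType) := Params {
  eps_f : R; eps_g : R; kappa_eg : R; eps_H : R; kappa_eh : R;
  p1 : R; p2 : R;
  L2 : R;
  eta1 : R; eta2 : R; gamma : R; r : R;
  kappa_fod : R; kappa_bhm : R
}.

Record params_ok (R : realType) (c : params R) : Prop := ParamsOk {
  eps_f_ge0 : 0 <= eps_f c;
  eps_g_bnd : 0 <= eps_g c <= 1;
  kappa_eg_ge0 : 0 <= kappa_eg c;
  eps_H_bnd : 0 <= eps_H c <= 1;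
  kappa_eh_ge0 : 0 <= kappa_eh c;
  p1_bnd : 1 / 2 <= p1 c <= 1;
  p2_bnd : 1 / 2 <= p2 c <= 1;
  eta1_bnd : 0 < eta1 c < 1;
  eta2_gt0 : 0 < eta2 c;
  gamma_bnd : 0 < gamma c < 1;
  r_gt0 : 0 < r c;
  kappa_fod_bnd : 0 < kappa_fod c <= 1;
  kappa_bhm_gt0 : 0 < kappa_bhm c
}.

Section constants.
Context {R : realType}.
Variable c : params R.

Definition p12 : R := p1 c * p2 c.

Let D : R := L2 c / 3 + 2 * kappa_eg c + kappa_eh c.
Let a : R := (1 - eta1 c) * kappa_fod c.

Definition C4 : R :=
  Num.min (1 / (kappa_bhm c + kappa_eg c))
    (Num.min (a / (D + 3 + a * kappa_eg c)) (1 / (kappa_eg c + eta2 c))).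

Definition C5 : R :=
  Num.max (1 / (kappa_bhm c + kappa_eg c))
    (Num.max (a / (D + 3 + a * kappa_eg c)) (1 / (kappa_eg c + eta2 c))).

Definition C6 : R :=
  Num.min (a / (D + 2 + a * kappa_eh c)) (1 / (kappa_eh c + eta2 c)).

Definition C7 : R :=
  Num.max ((a + 1) / (D + 2 + a * kappa_eh c)) (1 / (kappa_eh c + eta2 c)).

Definition C8 : R :=
  eta1 c * eta2 c * kappa_fod c / 2 * Num.min (eta2 c / kappa_bhm c) 1.

Definition optimality {n : nat} (phi : 'rV[R]_n -> R) (x : 'rV[R]_n) : R :=
  Num.max (C4 * enorm (grad phi x) - C5 * eps_g c)
          (- C6 * lambda_min (hess phi x) - C7 * eps_H c).

End constants.

Section oracles.
Context {R : realType} {n : nat}.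
Variables (c : params R) (phi : 'rV[R]_n -> R).

Definition bounded_noise {E0 : Type} (o0 : 'rV[R]_n -> E0 -> R) : Prop :=
  forall x e, `|o0 x e - phi x| <= eps_f c.

(* Accuracy of the answers g and H to a call with accuracy input delta at x. *)
Definition first_order_accurate (delta : R) (x g : 'rV[R]_n) : Prop :=
  enorm (g - grad phi x) <= eps_g c + kappa_eg c * delta.

Definition second_order_accurate (delta : R) (x : 'rV[R]_n) (H : 'M[R]_n) :
    Prop :=
  specnorm (H - hess phi x) <= eps_H c + kappa_eh c * delta.

End oracles.

Section algorithm_step.
Context {R : realType} {n : nat}.
Variables (c : params R) (phi : 'rV[R]_n -> R).

(* The column H s is the row s *m H^T. *)
Definition model (x g : 'rV[R]_n) (H : 'M[R]_n) (s : 'rV[R]_n) : R :=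
  phi x + dot g s + 1 / 2 * dot (s *m H^T) s.

Definition model_decrease (x g : 'rV[R]_n) (H : 'M[R]_n) (s : 'rV[R]_n) : R :=
  model x g H 0 - model x g H s.

Definition cauchy_length (delta : R) (g : 'rV[R]_n) (H : 'M[R]_n) : R :=
  if H == 0 then delta else Num.min (enorm g / specnorm H) delta.

Definition sufficient_step (delta : R) (x g : 'rV[R]_n) (H : 'M[R]_n)
    (s : 'rV[R]_n) : Prop :=
  enorm s <= delta /\
  kappa_fod c / 2 * Num.max (enorm g * cauchy_length delta g H)
                            (- lambda_min H * delta ^+ 2)
    <= model_decrease x g H s.

Definition rho (x g : 'rV[R]_n) (H : 'M[R]_n) (s : 'rV[R]_n) (f fplus : R) : R :=
  (f - fplus + r c) / model_decrease x g H s.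

(* Division by 0 returns 0 here, hence the explicit first conjunct. *)
Definition accept (x g : 'rV[R]_n) (H : 'M[R]_n) (s : 'rV[R]_n) (f fplus : R) :
    bool :=
  (model_decrease x g H s != 0) && (eta1 c <= rho x g H s f fplus).

Definition beta_model (g : 'rV[R]_n) (H : 'M[R]_n) : R :=
  Num.max (enorm g) (- lambda_min H).

Definition next_iterate (x g : 'rV[R]_n) (H : 'M[R]_n) (s : 'rV[R]_n)
    (f fplus : R) : 'rV[R]_n :=
  if accept x g H s f fplus then x + s else x.

Definition next_radius (delta : R) (x g : 'rV[R]_n) (H : 'M[R]_n)
    (s : 'rV[R]_n) (f fplus : R) : R :=
  if accept x g H s f fplus && (eta2 c * delta <= beta_model g H)
  then (gamma c)^-1 * delta else gamma c * delta.

End algorithm_step.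

(* The quantities produced along the run, as functions of the iteration and of
   the outcome: iterates, radii, gradient and Hessian estimates, steps, and the
   function values returned at the iterate and at the trial point. *)
Record process (R : realType) (n : nat) (Omega : Type) := Process {
  iter_ : nat -> Omega -> 'rV[R]_n;
  radius_ : nat -> Omega -> R;
  grad_ : nat -> Omega -> 'rV[R]_n;
  hess_ : nat -> Omega -> 'M[R]_n;
  step_ : nat -> Omega -> 'rV[R]_n;
  fval_ : nat -> Omega -> R;
  ftrial_ : nat -> Omega -> R
}.

Section stochastic_run.
Context {R : realType} {n : nat}.
Context {d d0 d1 d2 : measure_display} {Omega : measurableType d}.
Context {E0 : measurableType d0} {E1 : measurableType d1}
        {E2 : measurableType d2}.

(* xi0 k and xi0t k drive the zeroth-order calls at the iterate and at the trial
   point.  history k is the sigma-algebra generated by the randomness of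
   iterations 0, ..., k-1 (so history 0 is trivial). *)
Variables (xi0 xi0t : nat -> Omega -> E0) (xi1 : nat -> Omega -> E1)
          (xi2 : nat -> Omega -> E2).

Definition history (k : nat) : set_system Omega :=
  <<s \bigcup_(j in `I_k)
        (preimage_set_system setT (xi0 j) measurable `|`
         preimage_set_system setT (xi0t j) measurable `|`
         preimage_set_system setT (xi1 j) measurable `|`
         preimage_set_system setT (xi2 j) measurable) >>.

Variables (c : params R) (phi : 'rV[R]_n -> R).

(* The oracles take, besides the noise, the point x, and for the first- and
   second-order ones first the accuracy input and the reliability input. *)
Variables (o0 : 'rV[R]_n -> E0 -> R)
          (o1 : R -> R -> 'rV[R]_n -> E1 -> 'rV[R]_n)
          (o2 : R -> R -> 'rV[R]_n -> E2 -> 'M[R]_n).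
Variables (x0 : 'rV[R]_n) (delta0 : R).
Variable S : process R n Omega.

Record is_run : Prop := IsRun {
  run_iter0 : forall w, iter_ S 0 w = x0;
  run_radius0 : forall w, radius_ S 0 w = delta0;
  run_grad : forall k w,
    grad_ S k w = o1 (radius_ S k w ^+ 2) (p1 c) (iter_ S k w) (xi1 k w);
  run_hess : forall k w,
    hess_ S k w = o2 (radius_ S k w) (p2 c) (iter_ S k w) (xi2 k w);
  run_step : forall k w,
    sufficient_step c phi (radius_ S k w) (iter_ S k w) (grad_ S k w)
      (hess_ S k w) (step_ S k w);
  run_fval : forall k w, fval_ S k w = o0 (iter_ S k w) (xi0 k w);
  run_ftrial : forall k w,
    ftrial_ S k w = o0 (iter_ S k w + step_ S k w) (xi0t k w);
  run_iter : forall k w,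
    iter_ S k.+1 w =
      next_iterate c phi (iter_ S k w) (grad_ S k w) (hess_ S k w)
        (step_ S k w) (fval_ S k w) (ftrial_ S k w);
  run_radius : forall k w,
    radius_ S k.+1 w =
      next_radius c phi (radius_ S k w) (iter_ S k w) (grad_ S k w)
        (hess_ S k w) (step_ S k w) (fval_ S k w) (ftrial_ S k w)
}.

(* Everything computed in iteration k is determined, measurably, by the oracle
   randomness of iterations 0, ..., k; hence iterate and radius number k are
   measurable with respect to history k. *)
Record is_adapted : Prop := IsAdapted {
  adapted_grad : forall k, mx_adapted (history k.+1) (grad_ S k);
  adapted_hess : forall k, mx_adapted (history k.+1) (hess_ S k);
  adapted_step : forall k, mx_adapted (history k.+1) (step_ S k);
  adapted_fval : forall k, adapted (history k.+1) (fval_ S k);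
  adapted_ftrial : forall k, adapted (history k.+1) (ftrial_ S k)
}.

Definition grad_event (k : nat) : set Omega :=
  [set w | first_order_accurate c phi (radius_ S k w ^+ 2) (iter_ S k w)
             (grad_ S k w)].

Definition hess_event (k : nat) : set Omega :=
  [set w | second_order_accurate c phi (radius_ S k w) (iter_ S k w)
             (hess_ S k w)].

Record conditionally_reliable (P : probability Omega R) : Prop :=
  ConditionallyReliable {
  reliable_grad : forall k, cond_prob_ge P (history k) (grad_event k) (p1 c);
  reliable_hess : forall k, cond_prob_ge P (history k) (hess_event k) (p2 c);
  reliable_joint : forall k,
    cond_prob_ge P (history k) (grad_event k `&` hess_event k) (p12 c)
}.

End stochastic_run.

Definition logb {R : realType} (b x : R) : R := ln x / ln b.

(* min{eps / delta0, delta0 / b}, where delta0 / b is +oo if b <= 0. *)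
Definition radius_ratio {R : realType} (eps delta0 b : R) : R :=
  if b <= 0 then eps / delta0 else Num.min (eps / delta0) (delta0 / b).

(* Main.v *)
Require Import Defs.
From HB Require Import structures.
From mathcomp Require Import all_boot all_order all_algebra.
From mathcomp Require Import all_classical all_reals all_analysis.
From mathcomp Require Import measurable_realfun.
From mathcomp Require Import ring lra zify.
Import Order.TTheory GRing.Theory Num.Theory.
Import numFieldNormedType.Exports.
Local Open Scope classical_set_scope.
Local Open Scope ring_scope.

(** Along a run, call an iteration true when both derivative estimates are accurate,
and successful when its step is accepted and the radius increases. The proof
combines a deterministic bound on the number of true iterations with a
concentration inequality for that number.

Deterministic part. A true iteration whose radius is at most 1 and at most
the optimality measure at the iterate is successful (true_small_successful):
the constants C4, ..., C7 are chosen so that the model decrease then dominates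
the difference between phi and its model, which is controlled by a second-order
Taylor bound (phi_taylor). A successful iteration with radius at least
gamma eps lowers phi by h = C8 (gamma eps)^3 up to N = 2 eps_f + r
(successful_decrease), and no iteration raises phi by more than N. Suppose now that
the optimality measure exceeds eps in the first T iterations. On the logarithmic
scale the radius moves by one unit at each iteration, and below eps every true
iteration moves it up. Hence the true iterations in excess of T / 2 are at most the
successes above gamma eps plus half of the initial distance to eps and 1 / 2
(count_levels), while h times the number of those successes is at most
phi x0 - phi_low + N T. For T as in the theorem this makes the number of
true iterations at most phat T (true_iterations_le).

Probabilistic part. Conditionally on the past each iteration is true with
probability at least p12, so by Hoeffding's inequality for adapted events
(adapted_hoeffding) at most phat T iterations are true with probability at most
exp (- 2 (p12 - phat)^2 T), and p12 > 1 / 2 turns this into the stated bound.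

Two facts make the events involved measurable. Continuous functions of
measurable matrices are measurable (mx_measurable_comp), and the least eigenvalue of a
symmetric matrix is the minimum of its quadratic form on the unit sphere, which
depends continuously on the matrix (lambda_minE, continuous_rayleigh). The Hessian
of phi is symmetric by Schwarz's theorem, obtained here from the Taylor bounds
(hess_sym). *)

(** * Euclidean and spectral norms *)

Section euclidean.
Context {R : realType} {n : nat}.
Implicit Types (u v w : 'rV[R]_n) (A B : 'M[R]_n).

Lemma dotC u v : dot u v = dot v u.
Proof. by apply: eq_bigr => i _; rewrite mulrC. Qed.

Lemma dotDl u v w : dot (u + v) w = dot u w + dot v w.
Proof. by rewrite -big_split; apply: eq_bigr => i _; rewrite mxE mulrDl. Qed.

Lemma dotZl a u v : dot (a *: u) v = a * dot u v.
Proof. by rewrite /dot mulr_sumr; apply: eq_bigr => i _; rewrite mxE mulrA. Qed.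

Lemma dotDr u v w : dot u (v + w) = dot u v + dot u w.
Proof. by rewrite dotC dotDl !(dotC _ u). Qed.

Lemma dotZr a u v : dot u (a *: v) = a * dot u v.
Proof. by rewrite dotC dotZl dotC. Qed.

Lemma dotNl u v : dot (- u) v = - dot u v.
Proof. by rewrite -scaleN1r dotZl mulN1r. Qed.

Lemma dotNr u v : dot u (- v) = - dot u v.
Proof. by rewrite dotC dotNl dotC. Qed.

Lemma dotBl u v w : dot (u - v) w = dot u w - dot v w.
Proof. by rewrite dotDl dotNl. Qed.

Lemma dotBr u v w : dot u (v - w) = dot u v - dot u w.
Proof. by rewrite dotDr dotNr. Qed.

Lemma dot0l v : dot 0 v = 0.
Proof. by rewrite /dot big1 // => i _; rewrite mxE mul0r. Qed.

Lemma dot0r v : dot v 0 = 0.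
Proof. by rewrite dotC dot0l. Qed.

Lemma dot_mulmx u v A : dot (u *m A) v = dot u (v *m A^T).
Proof.
rewrite /dot; under eq_bigr do rewrite mxE mulr_suml.
rewrite exchange_big; apply: eq_bigr => i _ /=.
rewrite mxE mulr_sumr; apply: eq_bigr => j _.
by rewrite mxE -mulrA (mulrC (A i j)).
Qed.

Lemma dot_delta u i : dot u (delta_mx 0 i) = u 0 i.
Proof.
rewrite /dot (bigD1 i) //= mxE !eqxx mulr1 big1 ?addr0 // => j ji.
by rewrite mxE (negbTE ji) mulr0.
Qed.

Lemma dot_ge0 v : 0 <= dot v v.
Proof. by apply: sumr_ge0 => i _; rewrite -expr2 sqr_ge0. Qed.

Lemma dot_eq0 v : dot v v = 0 -> v = 0.
Proof.
move=> /eqP; rewrite psumr_eq0 => [/allP v0|i _]; last by rewrite -expr2 sqr_ge0.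
apply/rowP => i; rewrite mxE; apply/eqP.
by have := v0 i (mem_index_enum _); rewrite mulf_eq0 orbb.
Qed.

Lemma enorm_ge0 v : 0 <= enorm v.
Proof. exact: sqrtr_ge0. Qed.

Lemma enorm_sqr v : enorm v ^+ 2 = dot v v.
Proof. by rewrite sqr_sqrtr // dot_ge0. Qed.

Lemma enorm_eq0 v : enorm v = 0 -> v = 0.
Proof. by move=> v0; apply: dot_eq0; rewrite -enorm_sqr v0 expr0n. Qed.

Lemma enorm0 : enorm (0 : 'rV[R]_n) = 0.
Proof. by rewrite /enorm dot0l sqrtr0. Qed.

Lemma enormZ a v : enorm (a *: v) = `|a| * enorm v.
Proof.
by rewrite /enorm dotZl dotZr mulrA -expr2 sqrtrM ?sqr_ge0// sqrtr_sqr.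
Qed.

Lemma enormN v : enorm (- v) = enorm v.
Proof. by rewrite -scaleN1r enormZ normrN normr1 mul1r. Qed.

Lemma enorm_dist u v : enorm (u - v) = enorm (v - u).
Proof. by rewrite -enormN opprB. Qed.

Lemma cauchy_schwarz u v : `|dot u v| <= enorm u * enorm v.
Proof.
rewrite -(@ler_pXn2r _ 2%N) ?nnegrE ?mulr_ge0 ?enorm_ge0//.
rewrite exprMn !enorm_sqr real_normK ?num_real//.
have [v0|v0] := eqVneq (dot v v) 0.
  by rewrite v0 mulr0 (dot_eq0 _ v0) dot0r expr0n.
have vp : 0 < dot v v by rewrite lt_neqAle eq_sym v0 dot_ge0.
have := dot_ge0 (dot v v *: u - dot u v *: v).
rewrite dotBl !dotBr !dotZl !dotZr (dotC v u) => h.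
rewrite -subr_ge0 -(pmulr_rge0 _ vp).
by apply: le_trans h _; rewrite le_eqVlt; apply/orP; left; apply/eqP; ring.
Qed.

Lemma dot_le u v : dot u v <= enorm u * enorm v.
Proof. exact: le_trans (ler_norm _) (cauchy_schwarz u v). Qed.

Lemma dot_ge u v : - (enorm u * enorm v) <= dot u v.
Proof. by rewrite lerNl -dotNl -(enormN u) dot_le. Qed.

Lemma enormD u v : enorm (u + v) <= enorm u + enorm v.
Proof.
rewrite -(@ler_pXn2r _ 2%N) ?nnegrE ?addr_ge0 ?enorm_ge0//.
rewrite sqrrD !enorm_sqr dotDl !dotDr (dotC v u).
have := dot_le u v; lra.
Qed.

Lemma enorm_leD u v : enorm u <= enorm v + enorm (u - v).
Proof. by rewrite -{1}(subrK v u) addrC enormD. Qed.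

(** The topology of the matrix types comes from the sup norm, so this lemma and
enorm_le_sum are the bridge between it and the Euclidean norm. *)
Lemma ler_entry_enorm v i : `|v 0 i| <= enorm v.
Proof.
rewrite -(@ler_pXn2r _ 2%N) ?nnegrE ?enorm_ge0// enorm_sqr.
rewrite real_normK ?num_real// /dot (bigD1 i)//= -expr2 lerDl.
by apply: sumr_ge0 => j _; rewrite -expr2 sqr_ge0.
Qed.

Lemma enorm_le_sum v : enorm v <= \sum_i `|v 0 i|.
Proof.
rewrite -(@ler_pXn2r _ 2%N) ?nnegrE ?enorm_ge0 ?sumr_ge0// enorm_sqr.
rewrite expr2 mulr_suml; apply: ler_sum => i _.
apply: (@le_trans _ _ (`|v 0 i| * `|v 0 i|)).
  by rewrite -normrM ler_norm.
by rewrite ler_wpM2l// (bigD1 i)//= lerDl sumr_ge0.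
Qed.

Lemma enorm_mulmx_le v A :
  enorm (v *m A) <= (\sum_i \sum_j `|A i j|) * enorm v.
Proof.
apply: le_trans (enorm_le_sum _) _.
rewrite exchange_big mulr_suml; apply: ler_sum => j _.
rewrite mxE (le_trans (ler_norm_sum _ _ _))// mulr_suml.
apply: ler_sum => i _; rewrite normrM mulrC ler_wpM2l//.
exact: ler_entry_enorm.
Qed.

Let specset A := [set enorm (v *m A) | v in [set v | enorm v <= 1]].

(** A supremum is only meaningful for a bounded set; every bound on specnorm below
rests on this one. *)
Lemma specnorm_has_sup A : has_sup (specset A).
Proof.
split; first by exists (enorm (0 *m A)), 0 => //=; rewrite enorm0.
exists (\sum_i \sum_j `|A i j|) => _ [v /= v1 <-].
apply: le_trans (enorm_mulmx_le _ _) _.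
by rewrite ler_piMr// sumr_ge0// => i _; rewrite sumr_ge0.
Qed.

Lemma specnorm_ge0 A : 0 <= specnorm A.
Proof.
apply: ub_le_sup; first by case: (specnorm_has_sup A).
by exists 0; rewrite /= ?mul0mx enorm0.
Qed.

Lemma specnormP v A : enorm (v *m A) <= specnorm A * enorm v.
Proof.
have [v0|v0] := eqVneq (enorm v) 0.
  by rewrite v0 (enorm_eq0 _ v0) mul0mx enorm0 mulr0.
have vp : 0 < enorm v by rewrite lt_neqAle eq_sym v0 enorm_ge0.
rewrite -ler_pdivrMr//.
have -> : enorm (v *m A) / enorm v = enorm (((enorm v)^-1 *: v) *m A).
  by rewrite -scalemxAl enormZ ger0_norm ?invr_ge0 ?enorm_ge0// mulrC.
apply: ub_le_sup; first by case: (specnorm_has_sup A).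
exists ((enorm v)^-1 *: v) => //=.
by rewrite enormZ ger0_norm ?invr_ge0 ?enorm_ge0// mulVf.
Qed.

Lemma specnorm_le_sum A : specnorm A <= \sum_i \sum_j `|A i j|.
Proof.
apply: ge_sup; first by case: (specnorm_has_sup A).
move=> _ [v /= v1 <-]; apply: le_trans (enorm_mulmx_le _ _) _.
by rewrite ler_piMr// sumr_ge0// => i _; rewrite sumr_ge0.
Qed.

(** Needed because the Cauchy step divides by the spectral norm of a nonzero
matrix. *)
Lemma specnorm_eq0 A : specnorm A = 0 -> A = 0.
Proof.
move=> A0; apply/row_matrixP => i; rewrite row0 rowE; apply: enorm_eq0.
by apply/eqP; rewrite eq_le enorm_ge0 andbT (le_trans (specnormP _ _))// A0 mul0r.
Qed.

Lemma specnormD A B : specnorm (A + B) <= specnorm A + specnorm B.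
Proof.
apply: ge_sup; first by case: (specnorm_has_sup (A + B)).
move=> _ [v /= v1 <-]; rewrite mulmxDr (le_trans (enormD _ _))// lerD//.
  by rewrite (le_trans (specnormP _ _))// ler_piMr// specnorm_ge0.
by rewrite (le_trans (specnormP _ _))// ler_piMr// specnorm_ge0.
Qed.

Lemma quad_le v A : dot (v *m A) v <= specnorm A * enorm v ^+ 2.
Proof.
apply: le_trans (dot_le _ _) _; rewrite expr2 mulrA ler_wpM2r ?enorm_ge0//.
exact: specnormP.
Qed.

Lemma quad_ge v A : - (specnorm A * enorm v ^+ 2) <= dot (v *m A) v.
Proof.
rewrite lerNl; apply: le_trans (_ : enorm (v *m A) * enorm v <= _); last first.
  by rewrite expr2 mulrA ler_wpM2r ?enorm_ge0// specnormP.
by rewrite -dotNl -(enormN (v *m A)) dot_le.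
Qed.

End euclidean.

(** * Least eigenvalue and quadratic form *)

Section continuity.
Context {R : realType}.

Lemma continuous_sum {T : topologicalType} {I : Type} (s : seq I)
    (f : I -> T -> R) :
  (forall i, continuous (f i)) -> continuous (fun x => \sum_(i <- s) f i x).
Proof.
move=> cf; elim: s => [|i s IH] x.
  by under [X in continuous_at _ X]funext do rewrite big_nil; exact: cvg_cst.
under [X in continuous_at _ X]funext do rewrite big_cons.
by apply: cvgD; [exact: cf | exact: IH].
Qed.

Lemma entry_le_norm {m n : nat} (A : 'M[R]_(m, n)) i j : `|A i j| <= `|A|.
Proof.
rewrite {2}/Num.norm/= mx_normrE; apply/bigmax_geP; right => /=.
by exists (i, j).
Qed.

(** Both the spectral norm and the least value of a quadratic form satisfy this
one-sided estimate, which is symmetric in A and B and hence gives continuity. *)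
Lemma lipschitz_entries_continuous {m n : nat} (f : 'M[R]_(m, n) -> R) :
  (forall A B, f A <= f B + \sum_i \sum_j `|(A - B) i j|) -> continuous f.
Proof.
move=> lf A; apply/(@cvgrPdist_lt _ _ _ _ (nbhs_filter A)) => e e0.
pose K : R := (m * n)%:R + 1.
have K0 : 0 < K by rewrite ltr_wpDl.
have le_norm B : \sum_i \sum_j `|(B : 'M[R]_(m, n)) i j| <= (m * n)%:R * `|B|.
  rewrite natrM -mulrA -[m in m%:R]card_ord mulr_natl -sumr_const.
  apply: ler_sum => i _; rewrite -[n in n%:R]card_ord mulr_natl -sumr_const.
  by apply: ler_sum => j _; exact: entry_le_norm.
have eK0 : 0 < e / K by rewrite divr_gt0.

apply: (filterS _ (nbhsx_ballx A (e / K) eK0)) => B; rewrite mx_norm_ball /ball_ /= => AB.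
have small : (m * n)%:R * `|A - B| < e.
  apply: (@le_lt_trans _ _ (K * `|A - B|)); last by rewrite mulrC -ltr_pdivlMr.
  by rewrite ler_wpM2r// lerDl.
rewrite (le_lt_trans _ small)// ler_norml.
have := le_trans (lf A B) (lerD (lexx _) (le_norm _)).
have := le_trans (lf B A) (lerD (lexx _) (le_norm _)).
rewrite (distrC B A); lra.
Qed.

End continuity.

Section rayleigh.
Context {R : realType} {n : nat}.
Implicit Types (u v w : 'rV[R]_n) (A B : 'M[R]_n).

(** The least value of the quadratic form on the unit sphere: for a symmetric
matrix it is the least eigenvalue, but unlike the latter it depends continuously
on an arbitrary matrix. *)
Definition rayleigh A : R := inf [set dot (v *m A) v | v in [set v | enorm v = 1]].

Lemma continuous_quad A : continuous (fun v : 'rV[R]_n => dot (v *m A) v).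
Proof.
apply: continuous_sum => i v.
apply: (@cvgM _ _ (nbhs v)); last exact: coord_continuous.
under [X in X @ _ --> _]funext do rewrite mxE.
rewrite mxE; apply: (@continuous_sum _ _ _ _ (fun j (w : 'rV[R]_n) => w 0 j * A j i)).
by move=> j w; apply: (@cvgM _ _ (nbhs w)); [exact: coord_continuous|exact: cvg_cst].
Qed.

Lemma unit_sphere_compact : compact [set v : 'rV[R]_n | enorm v = 1].
Proof.
apply: bounded_closed_compact.
  exists 1; split=> // x x1 v /= v1; apply: ltW; apply: le_lt_trans x1.
  rewrite {1}/Num.norm/= mx_normrE; apply/bigmax_leP; split=> //= -[i j] _ /=.
  by rewrite ord1 -v1 ler_entry_enorm.
rewrite [X in closed X](_ : _ = (fun v => dot (v *m 1%:M) v) @^-1` [set 1]).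
  apply: closed_comp; first by move=> v _; exact: continuous_quad.
  exact: closed_eq.
apply/seteqP; split=> v /=; rewrite mulmx1 -enorm_sqr.
  by move=> ->; rewrite expr1n.
by move=> /eqP; rewrite sqrp_eq1 ?enorm_ge0// => /eqP.
Qed.

Lemma rayleigh_attained A : (0 < n)%N ->
  exists2 v, enorm v = 1 & rayleigh A = dot (v *m A) v.
Proof.
move=> n0; pose e : 'rV[R]_n := delta_mx 0 (Ordinal n0).
have sphere0 : [set v : 'rV[R]_n | enorm v = 1] !=set0.
  by exists e; rewrite /= /enorm dot_delta mxE !eqxx sqrtr1.
have [v v1 vmin] := compact_EVT_min sphere0 unit_sphere_compact
  (@continuous_subspaceT _ _ _ _ (@continuous_quad A)).
move: v1; rewrite inE /= => v1.
exists v => //; apply/eqP; rewrite eq_le; apply/andP; split.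
  apply: ge_inf; last by exists v.
  by exists (dot (v *m A) v) => _ [u /= u1 <-]; apply: vmin; rewrite inE.
apply: lb_le_inf; first by exists (dot (v *m A) v), v.
by move=> _ [u /= u1 <-]; apply: vmin; rewrite inE.
Qed.

Lemma rayleigh_le v A : rayleigh A * enorm v ^+ 2 <= dot (v *m A) v.
Proof.
have [v0|v0] := eqVneq (enorm v) 0.
  by rewrite (enorm_eq0 _ v0) mul0mx dot0l enorm0 expr0n mulr0.
have vp : 0 < enorm v by rewrite lt_neqAle eq_sym v0 enorm_ge0.
rewrite -ler_pdivlMr ?exprn_gt0//.
pose w := (enorm v)^-1 *: v.
have -> : dot (v *m A) v / enorm v ^+ 2 = dot (w *m A) w.
  by rewrite /w -scalemxAl dotZl dotZr; field.
apply: ge_inf; last first.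
  by exists w; rewrite /= /w ?enormZ ?ger0_norm ?invr_ge0 ?enorm_ge0 ?mulVf.
exists (- specnorm A) => _ [u /= u1 <-].
by have := quad_ge u A; rewrite u1 expr1n mulr1.
Qed.

(** Weyl's inequality: test the form of A on a minimiser for B. *)
Lemma rayleighD A B : (0 < n)%N -> rayleigh A <= rayleigh B + specnorm (A - B).
Proof.
move=> n0; have [v v1 ->] := rayleigh_attained B n0.
have := rayleigh_le v A; rewrite v1 expr1n mulr1 => /le_trans; apply.
rewrite -[in leLHS](subrK B A) mulmxDr dotDl addrC lerD2l.
by have := quad_le v (A - B); rewrite v1 expr1n mulr1.
Qed.

Lemma continuous_rayleigh : (0 < n)%N -> continuous rayleigh.
Proof.
move=> n0; apply: lipschitz_entries_continuous => A B.
by apply: le_trans (rayleighD A B n0) _; rewrite lerD2l specnorm_le_sum.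
Qed.

Lemma continuous_specnorm : continuous (@specnorm R n).
Proof.
apply: lipschitz_entries_continuous => A B.
rewrite -{1}(subrK B A) addrC (le_trans (specnormD _ _))// lerD2l.
exact: specnorm_le_sum.
Qed.

(** A minimiser v of the quadratic form on the sphere is an eigenvector: with mu
the minimum, t |-> q(v + t u) for the semi-definite form q of A - mu has its
minimum 0 at t = 0, so its linear coefficient vanishes. *)
Lemma lambda_minE A : (0 < n)%N -> A^T = A -> lambda_min A = rayleigh A.
Proof.
move=> n0 symA; have [v v1 muE] := rayleigh_attained A n0.
set mu := rayleigh A in muE *.
have mu_eig : eigenvalue A mu.
  apply/eigenvalueP; exists v; last first.
    by apply: contra_eqN v1 => /eqP ->; rewrite enorm0 eq_sym oner_neq0.
  have qge0 w : 0 <= dot (w *m A) w - mu * dot w w.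
    by rewrite subr_ge0 -enorm_sqr rayleigh_le.
  have vv : dot v v = 1 by rewrite -enorm_sqr v1 expr1n.
  apply/eqP; rewrite -subr_eq0; apply/eqP/dot_eq0.
  set u := v *m A - mu *: v.
  have uu : dot u u = dot (v *m A) u - mu * dot v u by rewrite {1}/u dotBl dotZl.
  clearbody u.
  set q := dot (u *m A) u - mu * dot u u.
  have quad t : 0 <= 2 * t * dot u u + t ^+ 2 * q.
    have := qge0 (v + t *: u).
    rewrite mulmxDl -scalemxAl !dotDl !dotDr !dotZl !dotZr.
    have -> : dot (u *m A) v = dot (v *m A) u.
      by rewrite dot_mulmx symA dotC.
    rewrite -muE vv (dotC u v) => h; apply: le_trans h _.
    rewrite /q uu le_eqVlt; apply/orP; left; apply/eqP; ring.
  have q0 : 0 <= q by exact: qge0.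
  (* A small negative t; dividing by q + 1 keeps it defined when q = 0. *)
  have := quad (- (dot u u / (q + 1))).
  have d0 := dot_ge0 u.
  have q1 : q + 1 != 0 by rewrite gt_eqF// ltr_wpDl.
  set s := dot u u / (q + 1).
  have sE : dot u u = s * (q + 1) by rewrite /s divfK.
  rewrite sE => h; have s0 : 0 <= s by rewrite divr_ge0// addr_ge0.
  suff -> : s = 0 by rewrite mul0r.
  by apply/eqP; rewrite -sqrf_eq0 eq_le sqr_ge0 andbT; nra.
have lb : lbound [set a | eigenvalue A a] mu.
  move=> a /= /eigenvalueP [w wA w0].
  have := rayleigh_le w A; rewrite wA dotZl -enorm_sqr ler_pM2r//.
  rewrite exprn_gt0// lt_neqAle enorm_ge0 andbT eq_sym.
  by apply: contraNneq w0 => /enorm_eq0 ->.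
apply/eqP; rewrite eq_le; apply/andP; split.
  by apply: ge_inf => //; exists mu.
by apply: lb_le_inf => //; exists mu.
Qed.

End rayleigh.

(** * Taylor bounds with a Lipschitz Hessian *)

Section calculus.
Context {R : realType}.

(** The mean value theorem applied to f - p. The Taylor bounds and Hoeffding's lemma
all reduce to it. *)
Lemma le_poly_of_derive (f df : R -> R) (p : {poly R}) :
  (forall t : R, is_derive t (1 : R) f (df t)) -> f 0 <= p.[0] ->
  (forall t, 0 <= t -> df t <= p^`().[t]) -> forall t, 0 <= t -> f t <= p.[t].
Proof.
move=> fdf f0 dfp t t0; pose g := f - horner p.
have gdg u : is_derive u (1 : R) g (df u - p^`().[u]).
  exact: is_deriveB (fdf u) (is_derive_poly p u).
suff : g t <= g 0 by rewrite /g !fctE; lra.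
have cg : {within `[0, t], continuous g}.
  apply: continuous_subspaceT => u; apply: differentiable_continuous.
  by apply/derivable1_diffP; have [] := gdg u.
have [c] := @MVT_segment R g (fun u => df u - p^`().[u]) 0 t t0
  (fun u _ => gdg u) cg.
rewrite in_itv /= => /andP[c0 _]; rewrite subr0 => gE.
rewrite -subr_le0 gE mulr_le0_ge0// subr_le0; exact: dfp c0.
Qed.

Lemma le_cubic_of_derive (f df : R -> R) (a0 a1 a2 a3 : R) :
  (forall t : R, is_derive t (1 : R) f (df t)) -> f 0 <= a0 ->
  (forall t, 0 <= t -> df t <= a1 + 2 * a2 * t + 3 * a3 * t ^+ 2) ->
  forall t, 0 <= t -> f t <= a0 + a1 * t + a2 * t ^+ 2 + a3 * t ^+ 3.
Proof.
move=> fdf f0 dfle t t0.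
pose p : {poly R} := a0%:P + a1 *: 'X + a2 *: 'X^2 + a3 *: 'X^3.
have pE u : p.[u] = a0 + a1 * u + a2 * u ^+ 2 + a3 * u ^+ 3.
  by rewrite /p !hornerD !hornerZ hornerC hornerX !hornerXn.
have dpE u : p^`().[u] = a1 + 2 * a2 * u + 3 * a3 * u ^+ 2.
  rewrite /p !derivD !derivZ derivC derivX !derivXn /= !hornerD !hornerZ.
  rewrite !hornerMn -polyC1 !hornerC ?hornerX !hornerXn; ring.
have := @le_poly_of_derive f df p fdf; rewrite !pE.
rewrite !expr0n /= !mulr0 !addr0 => /(_ f0) h.
by rewrite -pE; apply: h => // u u0; rewrite dpE; exact: dfle.
Qed.

(** The difference quotients of t |-> f (x + t s) are those of f in the direction
s, literally. *)
Lemma is_derive_line {V W : normedModType R} (f : V -> W) (x s : V) (t : R) :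
  differentiable f (x + t *: s) ->
  is_derive t (1 : R) (fun t => f (x + t *: s)) ('D_s f (x + t *: s)).
Proof.
move=> df.
have E : (fun h : R => h^-1 *: (((fun t => f (x + t *: s)) \o shift t) (h *: 1)
             - f (x + t *: s)))
       = (fun h : R => h^-1 *: ((f \o shift (x + t *: s)) (h *: s)
             - f (x + t *: s))).
  apply/funext => h /=; rewrite scalerDl addrCA /GRing.scale /= mulr1.
  by [].
have := diff_derivable (v := s) df.
by move=> dfs; split; rewrite /derivable /derive E.
Qed.

End calculus.

Section taylor.
Context {R : realType} {n : nat}.
Variables (phi : 'rV[R]_n -> R) (L : R).
Hypothesis phi_C2 : twice_continuously_differentiable phi.
Hypothesis phi_lip : lipschitz_hessian phi L.
Implicit Types (x u v s : 'rV[R]_n).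

Lemma derive_grad x s : 'D_s phi x = dot (grad phi x) s.
Proof.
have [dphi _ _] := phi_C2.
rewrite deriveE// {1}(row_sum_delta s) linear_sum /dot; apply: eq_bigr => i _.
by rewrite linearZ /= mxE deriveE// mulrC.
Qed.

Lemma is_derive_phi_line x s (t : R) :
  is_derive t (1 : R) (fun t => phi (x + t *: s)) (dot (grad phi (x + t *: s)) s).
Proof.
by have [dphi _ _] := phi_C2; rewrite -derive_grad; exact: is_derive_line.
Qed.

Lemma is_derive_grad_line x s v (t : R) :
  is_derive t (1 : R) (fun t => dot (grad phi (x + t *: s)) v)
                (dot (s *m hess phi (x + t *: s)) v).
Proof.
have [_ dgrad _] := phi_C2.
have [der val] := is_derive_line (grad phi) x s t (dgrad _).
have ders i := (derivable_mxP _ _ _).1 der 0 i.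
have jacE := deriveEjacobian s (dgrad (x + t *: s)).
rewrite derive_mx// jacE in val.
pose h i : R -> R := v 0 i \*: (fun t => grad phi (x + t *: s) 0 i).
have -> : (fun t => dot (grad phi (x + t *: s)) v) = \sum_(i < n) h i.
  by apply/funext => r; rewrite fct_sumE; apply: eq_bigr => i _; rewrite mulrC.
have -> : dot (s *m hess phi (x + t *: s)) v =
    \sum_i v 0 i *: 'D_(1 : R) (fun t : R => grad phi (x + t *: s) 0 i) t.
  apply: eq_bigr => i _; rewrite mulrC /hess -[in LHS]val mxE.
  by [].
apply: is_derive_sum => i; apply: is_deriveZ.
by apply: DeriveDef => //; exact: ders.
Qed.

Lemma hess_bilin_le x y u v :
  dot (u *m (hess phi y - hess phi x)) v
    <= L * enorm (y - x) * (enorm u * enorm v).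
Proof.
apply: le_trans (dot_le _ _) _.
rewrite mulrA ler_wpM2r ?enorm_ge0// (le_trans (specnormP _ _))//.
by rewrite ler_wpM2r ?enorm_ge0.
Qed.

(** The derivative of t |-> (grad phi (x + t u), v) exceeds its value at 0 by at most
L t |u|^2 |v|; integrating this gives the bound. As v is arbitrary, - v gives the
opposite inequality. *)
Lemma grad_taylor x u v :
  dot (grad phi (x + u)) v
    <= dot (grad phi x) v + dot (u *m hess phi x) v
       + L / 2 * enorm u ^+ 2 * enorm v.
Proof.
pose hu t := dot (u *m hess phi (x + t *: u)) v.
have := @le_cubic_of_derive R _ hu (dot (grad phi x) v) (dot (u *m hess phi x) v)
  (L / 2 * enorm u ^+ 2 * enorm v) 0 (is_derive_grad_line x u v).
rewrite scale0r addr0 lexx => /(_ isT) h.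
have {h} := h _ 1 ler01; rewrite scale1r !expr1n !mulr1 addr0; apply=> t t0.
have := hess_bilin_le x (x + t *: u) u v.
have -> : x + t *: u - x = t *: u by rewrite addrAC subrr add0r.
rewrite enormZ (ger0_norm t0) mulmxBr dotBl lerBlDl => /le_trans; apply.
by rewrite le_eqVlt; apply/orP; left; apply/eqP; field.
Qed.

(** The same argument once more, the derivative of t |-> phi (x + t s) being bounded
by grad_taylor. The sign e gives the upper and the lower bound at once. *)
Lemma phi_taylor (e : R) x s : `|e| = 1 ->
  e * phi (x + s)
    <= e * (phi x + dot (grad phi x) s + 1 / 2 * dot (s *m hess phi x) s)
       + L / 6 * enorm s ^+ 3.
Proof.
move=> e1.
suff h : e * phi (x + 1 *: s) <= e * phi x + e * dot (grad phi x) s * 1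
    + e / 2 * dot (s *m hess phi x) s * 1 ^+ 2 + L / 6 * enorm s ^+ 3 * 1 ^+ 3.
  rewrite scale1r in h; apply: le_trans h _.
  by rewrite le_eqVlt; apply/orP; left; apply/eqP; field.
apply: (@le_cubic_of_derive R (e \*: (fun t => phi (x + t *: s)))
  (fun t => e *: dot (grad phi (x + t *: s)) s) (e * phi x)
  (e * dot (grad phi x) s) (e / 2 * dot (s *m hess phi x) s)
  (L / 6 * enorm s ^+ 3)
  (fun t => is_deriveZ e (is_derive_phi_line x s t))) => //.
  by rewrite /= scale0r addr0 lexx.
move=> t t0; have := grad_taylor x (t *: s) (e *: s).
rewrite -scalemxAl !dotZl !dotZr !enormZ e1 (ger0_norm t0) => /le_trans; apply.
by rewrite le_eqVlt; apply/orP; left; apply/eqP; field.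
Qed.

(** Schwarz's theorem: expanding phi (x + t u + t v) at x, and at x + t u and then at
x, gives two second-order expansions whose difference in t ^ 2 is half of
H(u, v) - H(v, u); it must be O(t ^ 3). *)
Lemma hess_sym x : (hess phi x)^T = hess phi x.
Proof.
pose H := hess phi x.
suff sym u v : dot (v *m H) u <= dot (u *m H) v.
  apply/matrixP => i j; rewrite [LHS]mxE.
  have E k l : H k l = dot (delta_mx 0 k *m H) (delta_mx 0 l).
    by rewrite dot_delta -rowE [RHS]mxE.
  by apply/eqP; rewrite -/H !E eq_le !sym.
set a := enorm u; set b := enorm v; set d := enorm (u + v).
pose M := a ^+ 3 / 3 + a ^+ 2 * b + a * b ^+ 2 + b ^+ 3 / 3 + d ^+ 3 / 3.
have key t : 0 < t -> dot (v *m H) u - dot (u *m H) v <= L * M * t.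
  move=> t0.
  have := @phi_taylor 1 (x + t *: u) (t *: v) (normr1 _).
  have := @phi_taylor 1 x (t *: u) (normr1 _).
  have := grad_taylor x (t *: u) (t *: v).
  have := hess_bilin_le x (x + t *: u) (t *: v) (t *: v).
  have := @phi_taylor (-1) x (t *: (u + v)) (normrN1 _).
  have -> : x + t *: u + t *: v = x + t *: (u + v) by rewrite scalerDr addrA.
  rewrite !mul1r !mulN1r.
  have -> : x + t *: u - x = t *: u by rewrite addrAC subrr add0r.
  rewrite -/H; move: (hess phi (x + t *: u)) (grad phi (x + t *: u)) => H' g'.
  clearbody H; move: (grad phi x) => g.
  rewrite mulmxBr dotBl -!scalemxAl !dotZl !dotZr !enormZ (gtr0_norm t0).
  rewrite mulmxDl !dotDl !dotDr -/a -/b -/d.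
  rewrite -subr_ge0 => h1; rewrite -subr_ge0 => h2; rewrite -subr_ge0 => h3.
  rewrite -subr_ge0 => h4; rewrite -subr_ge0 => h5.
  rewrite -subr_ge0 -(pmulr_rge0 _ (exprn_gt0 2 t0)) /M.
  have two h : 0 <= h -> 0 <= 2 * h :> R by move=> h0; rewrite mulr_ge0.
  (* The five bounds are added with the weights that cancel all terms of order
     0 and 1 in t and leave t ^ 2 times the claim. *)
  apply: le_trans (addr_ge0 (addr_ge0 (addr_ge0 (addr_ge0 (two _ h1) h2)
    (two _ h3)) (two _ h4)) (two _ h5)) _.
  by rewrite le_eqVlt; apply/orP; left; apply/eqP; field.
have dle : dot (v *m H) u - dot (u *m H) v <= 0.
  have K0 : 0 < `|L * M| + 1 by rewrite ltr_wpDl.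
  apply/ler_addgt0Pr => e e0; rewrite add0r.
  apply: le_trans (key (e / (`|L * M| + 1)) _) _; first by rewrite divr_gt0.
  rewrite mulrCA ler_piMr ?(ltW e0)// ler_pdivrMr// mul1r.
  by rewrite (le_trans (ler_norm _))// lerDl.
by rewrite -subr_le0.
Qed.

End taylor.

(** * One iteration of the trust-region method *)

Section one_iteration.
Context {R : realType} {n : nat}.
Variables (c : params R) (phi : 'rV[R]_n -> R).
Hypothesis n_gt0 : (0 < n)%N.
Hypothesis c_ok : params_ok c.
Hypothesis phi_C2 : twice_continuously_differentiable phi.
Hypothesis phi_lip : lipschitz_hessian phi (L2 c).
Hypothesis r_lower : 2 * eps_f c + eps_g c `^ (3 / 2) <= r c.

Variables (delta : R) (x g : 'rV[R]_n) (H : 'M[R]_n) (s : 'rV[R]_n).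
Variables (f fplus : R).
Hypothesis delta_gt0 : 0 < delta.
Hypothesis H_sym : H^T = H.
Hypothesis H_bounded : specnorm H <= kappa_bhm c.
Hypothesis s_ok : sufficient_step c phi delta x g H s.
Hypothesis f_noise : `|f - phi x| <= eps_f c.
Hypothesis fplus_noise : `|fplus - phi (x + s)| <= eps_f c.

Let a : R := (1 - eta1 c) * kappa_fod c.
Let D : R := L2 c / 3 + 2 * kappa_eg c + kappa_eh c.
Let dec := model_decrease phi x g H s.

(** In positive dimension two distinct points exist, and they force the sign. *)
Lemma lipschitz_constant_ge0 : 0 <= L2 c.
Proof.
have e1 : enorm (delta_mx 0 (Ordinal n_gt0) : 'rV[R]_n) = 1.
  by rewrite /enorm dot_delta mxE !eqxx sqrtr1.
have := phi_lip (delta_mx 0 (Ordinal n_gt0)) 0.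
by rewrite subr0 e1 mulr1; apply: le_trans; exact: specnorm_ge0.
Qed.

Lemma cauchy_length_ge m :
  0 <= m -> m <= delta -> m * kappa_bhm c <= enorm g ->
  m <= cauchy_length delta g H.
Proof.
move=> m0 md mg; rewrite /cauchy_length; case: eqVneq => [//|H0].
have Hp : 0 < specnorm H.
  rewrite lt_neqAle specnorm_ge0 andbT eq_sym.
  by apply: contra H0 => /eqP/specnorm_eq0/eqP.
by rewrite le_min md andbT ler_pdivlMr// (le_trans _ mg)// ler_wpM2l.
Qed.

Lemma model_decreaseE : dec = - dot g s - 1 / 2 * dot (s *m H) s.
Proof.
by rewrite /dec /model_decrease /model H_sym mul0mx dot0r dot0r; ring.
Qed.

Lemma decrease_ge_gradient m :
  0 <= m -> m <= delta -> m * kappa_bhm c <= enorm g ->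
  kappa_fod c / 2 * (enorm g * m) <= dec.
Proof.
move=> m0 md mg; have [_] := s_ok; apply: le_trans.
have [/andP[k0 _]] := kappa_fod_bnd c_ok.
rewrite ler_wpM2l ?divr_ge0 ?(ltW k0)// le_max ler_wpM2l ?enorm_ge0//.
exact: cauchy_length_ge.
Qed.

Lemma decrease_ge_curvature :
  kappa_fod c / 2 * (- lambda_min H * delta ^+ 2) <= dec.
Proof.
have [_] := s_ok; apply: le_trans.
have [/andP[k0 _]] := kappa_fod_bnd c_ok.
by rewrite ler_wpM2l ?divr_ge0 ?(ltW k0)// le_max lexx orbT.
Qed.

Lemma decrease_ge0 : 0 <= dec.
Proof.
apply: le_trans (decrease_ge_gradient 0 _ _ _) => //; last 2 first.
- exact: ltW.
- by rewrite mul0r enorm_ge0.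
by rewrite !mulr0.
Qed.

Lemma accept_decrease : accept c phi x g H s f fplus ->
  phi (x + s) + eta1 c * dec <= phi x + (2 * eps_f c + r c).
Proof.
move=> /andP[dec0]; rewrite /rho ler_pdivlMr; last first.
  by rewrite lt_neqAle eq_sym dec0 decrease_ge0.
move: f_noise fplus_noise; rewrite !ler_norml -/dec; lra.
Qed.

(** The radius grows only when the model promises a decrease of order
min (delta ^ 2, delta ^ 3), which is at least e ^ 3 whatever the size of
delta >= e. *)
Lemma successful_decrease (e : R) : 0 <= e -> e <= 1 -> e <= delta ->
  accept c phi x g H s f fplus -> eta2 c * delta <= beta_model g H ->
  phi (x + s) + C8 c * e ^+ 3 <= phi x + (2 * eps_f c + r c).
Proof.
move=> e0 e1 ed acc bm; apply: le_trans (accept_decrease acc).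
rewrite lerD2l.
have /andP[h0 h1] := eta1_bnd c_ok; have h2 := eta2_gt0 c_ok.
have /andP[k0 k1] := kappa_fod_bnd c_ok; have kb := kappa_bhm_gt0 c_ok.
set q := Num.min (eta2 c / kappa_bhm c) 1.
have q0 : 0 < q by rewrite lt_min divr_gt0/=.
have q1 : q <= 1 by rewrite ge_min lexx orbT.
have qk : q * kappa_bhm c <= eta2 c by rewrite -ler_pdivlMr// ge_min lexx.
suff main : eta2 c * kappa_fod c / 2 * q * e ^+ 3 <= dec.
  rewrite /C8 -/q.
  have -> : eta1 c * eta2 c * kappa_fod c / 2 * q * e ^+ 3 =
    eta1 c * (eta2 c * kappa_fod c / 2 * q * e ^+ 3) by ring.
  by rewrite ler_wpM2l// ltW.
have d0 := ltW delta_gt0.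
move: bm; rewrite /beta_model le_max => /orP[] bm.
  apply: le_trans (decrease_ge_gradient (q * delta) _ _ _).
  - have -> : eta2 c * kappa_fod c / 2 * q * e ^+ 3 =
      kappa_fod c / 2 * (q * (eta2 c * e ^+ 3)) by ring.
    rewrite ler_wpM2l ?divr_ge0 ?(ltW k0)// [leRHS]mulrCA ler_wpM2l ?(ltW q0)//.
    apply: le_trans (ler_wpM2r d0 bm); rewrite -mulrA ler_wpM2l ?(ltW h2)//.
    rewrite exprS expr2; apply: le_trans (_ : e * e <= _); last by rewrite ler_pM.
    by rewrite ler_wpM2l// ler_piMl.
  - by rewrite mulr_ge0// ltW.
  - by rewrite ler_piMl.
  - by apply: le_trans bm; rewrite mulrAC ler_wpM2r.
apply: le_trans decrease_ge_curvature.
have -> : eta2 c * kappa_fod c / 2 * q * e ^+ 3 =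
  kappa_fod c / 2 * (q * (eta2 c * e ^+ 3)) by ring.
rewrite ler_wpM2l ?divr_ge0 ?(ltW k0)//.
apply: (@le_trans _ _ (eta2 c * delta * delta ^+ 2)); last first.
  by rewrite ler_wpM2r ?exprn_ge0.
rewrite -mulrA -exprS; apply: le_trans (_ : eta2 c * e ^+ 3 <= _).
  by rewrite ler_piMl// mulr_ge0 ?exprn_ge0// ltW.
by rewrite ler_wpM2l ?(ltW h2)// lerXn2r// nnegrE.
Qed.

(** An accepted step may increase phi because of the noise and of the relaxation r
of the acceptance test, but never by more than their total. *)
Lemma next_iterate_phi :
  phi (next_iterate c phi x g H s f fplus) <= phi x + (2 * eps_f c + r c).
Proof.
rewrite /next_iterate; case: ifP => [acc|_].
  apply: le_trans (accept_decrease acc); rewrite lerDl mulr_ge0 ?decrease_ge0//.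
  by have /andP[/ltW] := eta1_bnd c_ok.
rewrite lerDl addr_ge0 ?mulr_ge0 ?(eps_f_ge0 c_ok)// ltW//; exact: r_gt0.
Qed.

Section true_iteration.
Hypothesis g_acc : first_order_accurate c phi (delta ^+ 2) x g.
Hypothesis H_acc : second_order_accurate c phi delta x H.
Hypothesis delta_le1 : delta <= 1.
Hypothesis delta_le_beta : delta <= optimality c phi x.

Lemma D_ge0 : 0 <= D.
Proof.
by rewrite !addr_ge0 ?mulr_ge0 ?invr_ge0 ?lipschitz_constant_ge0
  ?(kappa_eg_ge0 c_ok) ?(kappa_eh_ge0 c_ok).
Qed.

Lemma a_gt0 : 0 < a.
Proof.
have /andP[h0 h1] := eta1_bnd c_ok; have /andP[k0 k1] := kappa_fod_bnd c_ok.
by rewrite mulr_gt0// subr_gt0.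
Qed.

(** Taylor's bound for phi against the model: the errors in the gradient, in the
Hessian and in the remainder are of order delta ^ 3, up to the irreducible
errors eps_g and eps_H. *)
Lemma model_error :
  phi (x + s) - phi x
    <= - dec + 1 / 2 * (D * delta ^+ 3 + 2 * eps_g c * delta
                        + eps_H c * delta ^+ 2).
Proof.
have d0 := ltW delta_gt0.
have [sd _] := s_ok; have s0 := enorm_ge0 s.
have /andP[eg0 _] := eps_g_bnd c_ok; have /andP[eH0 _] := eps_H_bnd c_ok.
have kg0 := kappa_eg_ge0 c_ok; have kh0 := kappa_eh_ge0 c_ok.
have L0 := lipschitz_constant_ge0.
have := phi_taylor phi (L2 c) phi_C2 phi_lip 1 x s (normr1 _); rewrite !mul1r.
have ge : - ((eps_g c + kappa_eg c * delta ^+ 2) * delta)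
    <= dot (g - grad phi x) s.
  apply: le_trans (dot_ge _ _); rewrite lerN2.
  by rewrite ler_pM ?enorm_ge0.
have he : - ((eps_H c + kappa_eh c * delta) * delta ^+ 2)
    <= dot (s *m (H - hess phi x)) s.
  apply: le_trans (quad_ge _ _); rewrite lerN2.
  by rewrite ler_pM ?specnorm_ge0 ?exprn_ge0// lerXn2r// nnegrE.
have l3 : L2 c / 6 * enorm s ^+ 3 <= L2 c / 6 * delta ^+ 3.
  by rewrite ler_wpM2l ?divr_ge0// lerXn2r// nnegrE.
move: ge he; rewrite dotBl mulmxBr dotBl model_decreaseE /D.
lra.
Qed.

(** The term of the model error linear in eps_g is what the surplus
eps_g ^ (3 / 2) in r is for. With w = sqrt eps_g the left-hand side is
2 w ^ 2 (delta - w): it is nonpositive when delta <= w, and at most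
2 delta ^ 3 otherwise. *)
Lemma noise_absorbed :
  2 * eps_g c * delta - 2 * eps_g c `^ (3 / 2) <= 2 * delta ^+ 3.
Proof.
have /andP[eg0 _] := eps_g_bnd c_ok.
set w := Num.sqrt (eps_g c).
have w0 : 0 <= w by exact: sqrtr_ge0.
have egE : eps_g c = w ^+ 2 by rewrite sqr_sqrtr.
have -> : eps_g c `^ (3 / 2) = w ^+ 3.
  by rewrite mulrC powRrM powR12_sqrt// -powR_mulrn.
rewrite egE; case: (leP delta w) => dw.
  have : w ^+ 2 * (w - delta) >= 0 by rewrite mulr_ge0 ?exprn_ge0 ?subr_ge0.
  have : 0 <= delta ^+ 3 by rewrite exprn_ge0 ?ltW.
  lra.
have : w ^+ 2 * delta <= delta ^+ 2 * delta.
  by rewrite ler_wpM2r ?(ltW delta_gt0)// lerXn2r ?nnegrE ?(ltW dw) ?(ltW delta_gt0).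
have : 0 <= w ^+ 3 by rewrite exprn_ge0.
lra.
Qed.

(** Acceptance follows once a fraction 1 - eta1 of the model decrease covers what
remains of the model error after noise_absorbed. *)
Lemma accept_of_decrease : 0 < dec ->
  1 / 2 * ((D + 2) * delta ^+ 3 + eps_H c * delta ^+ 2) <= (1 - eta1 c) * dec ->
  accept c phi x g H s f fplus.
Proof.
move=> dec0 hdec; rewrite /accept -/dec gt_eqF//= /rho -/dec ler_pdivlMr//.
move: f_noise fplus_noise; rewrite !ler_norml.
have := model_error; have := noise_absorbed; have := r_lower.
lra.
Qed.

(** C4 and C6 are minima, and C5 and C7 maxima, of several weights, so one lower
bound on the optimality measure yields one lower bound for each weight. *)
Lemma weight_le (c1 c2 q1 q2 X e t : R) : 0 <= X -> 0 <= e ->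
  c1 <= q1 -> q2 <= c2 -> t <= c1 * X - c2 * e -> t + q2 * e <= q1 * X.
Proof.
move=> X0 e0 c1q c2q; rewrite lerBrDr => /le_trans - /(_ _ (ler_wpM2r X0 c1q)).
by apply: le_trans; rewrite lerD2l ler_wpM2r.
Qed.

Lemma weight_gradient (q : R) : 0 < q ->
  C4 c <= q^-1 -> q^-1 <= C5 c ->
  delta <= C4 c * enorm (grad phi x) - C5 c * eps_g c ->
  q * delta + eps_g c <= enorm (grad phi x).
Proof.
move=> q0 c4 c5; have /andP[eg0 _] := eps_g_bnd c_ok.
move=> /(weight_le _ _ _ _ _ _ _ (enorm_ge0 _) eg0 c4 c5).
by rewrite -(ler_pM2l q0) mulrDr !mulrA mulfV ?gt_eqF// !mul1r.
Qed.

Lemma enorm_grad_le :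
  enorm (grad phi x) <= enorm g + (eps_g c + kappa_eg c * delta ^+ 2).
Proof.
by apply: le_trans (enorm_leD _ g) _; rewrite lerD2l enorm_dist.
Qed.

Lemma sqr_delta_le : delta ^+ 2 <= delta.
Proof. by rewrite expr2 ler_piMl// ltW. Qed.

(** The three weights in C4 and C5 give, in order: the Cauchy step is not shortened
by the curvature of the model, the model decrease dominates the model error,
and the model gradient passes the test for increasing the radius. *)
Lemma accept_of_gradient :
  delta <= C4 c * enorm (grad phi x) - C5 c * eps_g c ->
  accept c phi x g H s f fplus /\ eta2 c * delta <= enorm g.
Proof.
move=> big; have d0 := ltW delta_gt0.
have kg0 := kappa_eg_ge0 c_ok; have D0 := D_ge0; have a0 := a_gt0.
have h2 := eta2_gt0 c_ok; have kb := kappa_bhm_gt0 c_ok.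
have /andP[h0 h1] := eta1_bnd c_ok.
have aE : 0 < D + 3 + a * kappa_eg c.
  by apply: ltr_wpDr; [rewrite mulr_ge0// ltW | apply: ltr_wpDl].
have kd : kappa_eg c * delta ^+ 2 <= kappa_eg c * delta.
  by rewrite ler_wpM2l// sqr_delta_le.
have gle := enorm_grad_le.
have w1 : (kappa_bhm c + kappa_eg c) * delta + eps_g c <= enorm (grad phi x).
  apply: weight_gradient => //; first by rewrite ltr_wpDr.
  - by rewrite /C4 !div1r ge_min lexx.
  - by rewrite /C5 !div1r le_max lexx.
have w2 : (D + 3 + a * kappa_eg c) / a * delta + eps_g c <= enorm (grad phi x).
  apply: weight_gradient => //; first by rewrite divr_gt0.
  - by rewrite invf_div /C4 !ge_min lexx orbT.
  - by rewrite invf_div /C5 !le_max lexx orbT.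
have w3 : (kappa_eg c + eta2 c) * delta + eps_g c <= enorm (grad phi x).
  apply: weight_gradient => //; first by rewrite ltr_wpDl.
  - by rewrite /C4 !div1r !ge_min lexx !orbT.
  - by rewrite /C5 !div1r !le_max lexx !orbT.
have g2 : eta2 c * delta <= enorm g by lra.
have g1 : delta * kappa_bhm c <= enorm g by lra.
have g3 : (D + 3) * delta <= a * enorm g.
  have : (D + 3 + a * kappa_eg c) * delta
      <= a * (enorm g + kappa_eg c * delta).
    rewrite -ler_pdivrMl// mulrA (mulrC a^-1); lra.
  lra.
have := decrease_ge_gradient delta d0 (lexx _) g1 => dge.
have g0 : 0 < enorm g by apply: lt_le_trans g2; rewrite mulr_gt0.
split=> //; apply: accept_of_decrease.
  apply: lt_le_trans dge; rewrite mulr_gt0 ?mulr_gt0 ?invr_gt0//.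
  by have /andP[] := kappa_fod_bnd c_ok.
have : (1 - eta1 c) * (kappa_fod c / 2 * (enorm g * delta))
    <= (1 - eta1 c) * dec by rewrite ler_wpM2l// subr_ge0 ltW.
apply: le_trans.
have -> : (1 - eta1 c) * (kappa_fod c / 2 * (enorm g * delta)) =
  1 / 2 * (a * enorm g * delta) by rewrite /a; field.
rewrite ler_wpM2l// (le_trans _ (ler_wpM2r d0 g3))//.
have /andP[_ eH1] := eps_H_bnd c_ok.
have d3 : (D + 2) * delta ^+ 3 <= (D + 2) * delta ^+ 2.
  apply: ler_wpM2l; first by rewrite addr_ge0.
  by rewrite exprS ler_piMl// exprn_ge0.
have eHd : eps_H c * delta ^+ 2 <= 1 * delta ^+ 2.
  by rewrite ler_wpM2r ?exprn_ge0.
move: d3 eHd; rewrite !expr2; lra.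
Qed.

(** By Weyl's inequality the model inherits the negative curvature of phi; the two
weights in C6 and C7 give the domination of the model error and the test for
increasing the radius. *)
Lemma accept_of_curvature :
  delta <= - C6 c * lambda_min (hess phi x) - C7 c * eps_H c ->
  accept c phi x g H s f fplus /\ eta2 c * delta <= - lambda_min H.
Proof.
move=> big; have d0 := ltW delta_gt0.
have kh0 := kappa_eh_ge0 c_ok; have D0 := D_ge0; have a0 := a_gt0.
have h2 := eta2_gt0 c_ok; have /andP[h0 h1] := eta1_bnd c_ok.
have /andP[eH0 _] := eps_H_bnd c_ok.
have aE : 0 < D + 2 + a * kappa_eh c.
  by apply: ltr_wpDr; [rewrite mulr_ge0// ltW | apply: ltr_wpDl].
have hE : 0 < kappa_eh c + eta2 c by rewrite ltr_wpDl.
set l := lambda_min (hess phi x) in big *.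
have weyl : lambda_min H <= l + (eps_H c + kappa_eh c * delta).
  rewrite /l !lambda_minE ?(hess_sym phi (L2 c))//.
  by apply: le_trans (rayleighD _ (hess phi x) n_gt0) _; rewrite lerD2l.
have C6_gt0 : 0 < C6 c by rewrite lt_min !divr_gt0.
have C7_ge0 : 0 <= C7 c.
  by rewrite le_max; apply/orP; right; rewrite divr_ge0// ltW.
rewrite mulNr -mulrN in big.
have nl0 : 0 <= - l.
  rewrite -(pmulr_rge0 _ C6_gt0); move: big; rewrite lerBrDr; apply: le_trans.
  by rewrite addr_ge0// mulr_ge0.
have w1 : (kappa_eh c + eta2 c) * delta + eps_H c <= - l.
  have h6 : C6 c <= (kappa_eh c + eta2 c)^-1.
    by rewrite /C6 !div1r ge_min lexx orbT.
  have h7 : (kappa_eh c + eta2 c)^-1 <= C7 c.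
    by rewrite /C7 !div1r le_max lexx orbT.
  have := weight_le _ _ _ _ _ _ _ nl0 eH0 h6 h7 big.
  by rewrite -(ler_pM2l hE) mulrDr !mulrA mulfV ?gt_eqF// !mul1r.
have w2 : (D + 2 + a * kappa_eh c) * delta + (a + 1) * eps_H c <= a * - l.
  have h6 : C6 c <= a / (D + 2 + a * kappa_eh c) by rewrite ge_min lexx.
  have h7 : (a + 1) / (D + 2 + a * kappa_eh c) <= C7 c by rewrite le_max lexx.
  have := weight_le _ _ _ _ _ _ _ nl0 eH0 h6 h7 big.
  have E y z : (D + 2 + a * kappa_eh c) * (y / (D + 2 + a * kappa_eh c) * z)
      = y * z by rewrite mulrA mulrCA mulfV ?gt_eqF// mulr1.
  by rewrite -(ler_pM2l aE) mulrDr !E.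
have l2 : eta2 c * delta <= - lambda_min H.
  rewrite lerNr (le_trans weyl)// -lerBrDr -opprD lerNr (le_trans _ w1)//.
  by rewrite le_eqVlt; apply/orP; left; apply/eqP; ring.
have l3 : (D + 2) * delta + eps_H c <= a * - lambda_min H.
  have h : a * lambda_min H <= a * (l + (eps_H c + kappa_eh c * delta)).
    by rewrite ler_wpM2l// ltW.
  rewrite mulrN lerNr (le_trans h)// mulrDr -lerBrDr -opprD lerNr -mulrN (le_trans _ w2)//.
  by rewrite le_eqVlt; apply/orP; left; apply/eqP; ring.
have dge := decrease_ge_curvature.
have l0 : 0 < - lambda_min H by apply: lt_le_trans l2; rewrite mulr_gt0.
split=> //; apply: accept_of_decrease.
  apply: lt_le_trans dge; rewrite mulr_gt0 ?mulr_gt0 ?invr_gt0 ?exprn_gt0//.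
  by have /andP[] := kappa_fod_bnd c_ok.
have : (1 - eta1 c) * (kappa_fod c / 2 * (- lambda_min H * delta ^+ 2))
    <= (1 - eta1 c) * dec by rewrite ler_wpM2l// subr_ge0 ltW.
apply: le_trans.
have -> : (1 - eta1 c) * (kappa_fod c / 2 * (- lambda_min H * delta ^+ 2)) =
  1 / 2 * (a * - lambda_min H * delta ^+ 2) by rewrite /a; field.
have d2 : 0 <= delta ^+ 2 by rewrite exprn_ge0.
rewrite ler_wpM2l// (le_trans _ (ler_wpM2r d2 l3))//.
by rewrite le_eqVlt; apply/orP; left; apply/eqP; ring.
Qed.

Lemma true_small_successful :
  accept c phi x g H s f fplus && (eta2 c * delta <= beta_model g H).
Proof.
move: delta_le_beta; rewrite /optimality /beta_model le_max.
case/orP => [/accept_of_gradient|/accept_of_curvature] [-> h] /=;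
  by rewrite le_max h ?orbT.
Qed.

End true_iteration.
End one_iteration.

(** * Counting true iterations along a path *)

Section counting.
Context {R : realType}.

(** Each iteration changes |m| by one. It brings m closer to 0 when it is true and
fails (then m > 0), or when it succeeds at a level m < 0; so twice the number of
true iterations is bounded, iteration by iteration, by 1 + 2 [success at a
level m >= 0] minus the increment of |m|. *)
Lemma count_levels (T : nat) (m : nat -> int) (up tr : nat -> bool) :
  (forall k, m k.+1 = if up k then m k + 1 else m k - 1) ->
  (forall k, (k < T)%N -> tr k -> m k <= 0 -> up k) ->
  (2 * \sum_(k < T) tr k + `|m T|%N
     <= T + 2 * \sum_(k < T) (up k && (0 <= m k)%R) + `|m 0|%N)%N.
Proof.
move=> mS; elim: T => [|T IH] tr_up; first by rewrite !big_ord0; lia.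
have {}IH := IH (fun k kT => tr_up k (ltnW kT)).
rewrite !big_ord_recr /=.
have := tr_up T (ltnSn T); have := mS T.
case: (up T); case: (tr T) => /= E; move=> H; move: IH;
  set s1 := (\sum_(k < T) _)%N; set s2 := (\sum_(k < T) _)%N;
  case: (lerP 0 (m T)) => mT; rewrite E; lia.
Qed.

Lemma sum_decrease (T : nat) (ph : nat -> R) (big : nat -> bool) (h N : R) :
  (forall k, ph k.+1 + h * (big k)%:R <= ph k + N) ->
  ph T + h * (\sum_(k < T) big k)%N%:R <= ph 0 + N * T%:R.
Proof.
move=> step; elim: T => [|T IH]; first by rewrite big_ord0 !mulr0 !addr0.
rewrite big_ord_recr /= natrD mulrDr -natr1 mulrDr mulr1.
have := step T; lra.
Qed.

(** Rounding the logarithmic distance from d0 to e up to an integer m0: the radius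
d0 gam ^ m0 at level 0 of the grid through d0 lies in the interval
from gam e, excluded, to e. *)
Lemma logb_level (gam e d0 : R) : 0 < gam < 1 -> 0 < e -> 0 < d0 ->
  exists2 m0 : int, `|m0|%N%:R <= `|logb gam (e / d0)| + 1 &
    ln gam + ln e < ln d0 + m0%:~R * ln gam <= ln e.
Proof.
move=> /andP[g0 g1] e0 d00; set w := logb gam (e / d0).
have lg : ln gam < 0 by rewrite ln_lt0// g0.
have wE : w * ln gam = ln e - ln d0.
  by rewrite /w /logb divfK ?lt_eqF// ln_div.
exists (Num.ceil w).
  have h1 := ceil_ge w.
  have h2 : (Num.ceil w)%:~R < w + 1.
    by have := ceilB1_lt w; rewrite rmorphB /= ltrBlDr.
  move: h1 h2; set m := Num.ceil w => h1 h2.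
  have -> : `|m|%N%:R = `|m%:~R : R| by rewrite -intr_norm natr_absz.
  rewrite ler_norml; have := ler_norm w; have := ler_norm (- w).
  rewrite normrN; lra.
have h1 := ceil_ge w.
have h2 : (Num.ceil w)%:~R < w + 1.
  by have := ceilB1_lt w; rewrite rmorphB /= ltrBlDr.
have : (Num.ceil w)%:~R * ln gam <= w * ln gam by rewrite ler_wnM2r// ltW.
have : (w + 1) * ln gam < (Num.ceil w)%:~R * ln gam by rewrite ltr_nM2r.
rewrite mulrDl wE; lra.
Qed.

(** The radius moves by one step on the logarithmic scale, and true iterations
below the threshold e push it up; so true iterations beyond half of the total
must be paid for either by the initial distance to the threshold or by
successful iterations with radius at least gam * e, each of which lowers
ph by h up to the noise N. *)
Lemma count_true_iterations (T : nat) (dl ph : nat -> R) (up tr : nat -> bool)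
    (gam e h N low l p : R) :
  0 < gam < 1 -> 0 < e -> 0 < dl 0 -> 0 < h ->
  (forall k, dl k.+1 = if up k then gam^-1 * dl k else gam * dl k) ->
  (forall k, (k < T)%N -> tr k -> dl k <= e -> up k) ->
  (forall k, ph k.+1 <= ph k + N) ->
  (forall k, up k -> gam * e <= dl k -> ph k.+1 + h <= ph k + N) ->
  (forall k, low <= ph k) ->
  `|logb gam (e / dl 0)| <= l ->
  0 < p - 1 / 2 - N / h ->
  (p - 1 / 2 - N / h)^-1 * ((ph 0 - low) / h + 1 / 2 * l + 1 / 2) <= T%:R ->
  (\sum_(k < T) tr k)%N%:R <= p * T%:R.
Proof.
move=> gam01 e0 dl0 h0 dlS tr_up phS ph_up ph_low l_ge q0 T_ge.
have /andP[g0 g1] := gam01.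
have [m0 m0_le /andP[lo hi]] := logb_level gam e (dl 0) gam01 e0 dl0.
have lg : ln gam < 0 by rewrite ln_lt0// g0.
(* m k is the level of dl k on the grid dl 0 * gam ^ (m0 - m). *)
pose m := fix m k := if k is k'.+1 then
  (if up k' then m k' + 1 else m k' - 1) else m0.
have dl_gt0 k : 0 < dl k.
  elim: k => // k IH; rewrite dlS; case: (up k); rewrite mulr_gt0// invr_gt0//.
have dlE k : ln (dl k) = ln (dl 0) + m0%:~R * ln gam - (m k)%:~R * ln gam.
  elim: k => [|k IH] /=; first by rewrite addrK.
  rewrite dlS; case: (up k).
    rewrite lnM ?posrE ?invr_gt0// lnV ?posrE// IH rmorphD /=; ring.
  rewrite lnM ?posrE// IH rmorphB /=; ring.
have small k : m k <= 0 -> dl k <= e.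
  move=> mk; rewrite -ler_ln ?posrE// dlE.
  have : 0 <= (m k)%:~R * ln gam by rewrite mulr_le0 ?lerz0// ltW.
  lra.
have large k : 0 <= m k -> gam * e <= dl k.
  move=> mk; rewrite -ler_ln ?posrE ?mulr_gt0// dlE lnM ?posrE//.
  have : (m k)%:~R * ln gam <= 0 by rewrite mulr_ge0_le0 ?ler0z// ltW.
  lra.
have cnt := @count_levels T m up tr (fun=> erefl)
  (fun k kT trk mk => tr_up k kT trk (small k mk)).
have dec := @sum_decrease T ph (fun k => up k && (0 <= m k)) h N.
move: cnt dec; set t := (\sum_(k < T) tr k)%N; set s := (\sum_(k < T) _)%N.
move=> cnt dec.
have {}dec : ph T + h * s%:R <= ph 0 + N * T%:R.
  apply: dec => k; case: (boolP (up k && (0 <= m k))) => [/andP[upk mk]|_]; rewrite ?mulr1 ?mulr0 ?addr0.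
    by apply: ph_up => //; exact: large.
  exact: phS.
have s_le : s%:R <= (ph 0 - low) / h + N / h * T%:R.
  rewrite mulrAC -mulrDl ler_pdivlMr// mulrC.
  have := ph_low T; lra.
have {}cnt : 2 * t%:R <= T%:R + 2 * s%:R + `|m0|%N%:R :> R.
  by rewrite -!natrM -!natrD ler_nat; apply: leq_trans cnt; rewrite leq_addr.
have qT : (ph 0 - low) / h + 1 / 2 * l + 1 / 2 <= (p - 1 / 2 - N / h) * T%:R.
  by rewrite -ler_pdivrMl.
move: qT s_le m0_le l_ge cnt; rewrite !mulrBl.
move: (N / h * T%:R) (p * T%:R) ((ph 0 - low) / h) => A B C; clear.
move: (t%:R) (s%:R) (`|m0|%N%:R) (`|logb _ _|) (T%:R) => t' s' m' l' T'; lra.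
Qed.

End counting.

(** * Concentration for adapted events *)

Section hoeffding.
Context {R : realType}.

(** Hoeffding's lemma for a Bernoulli variable: with
D(t) = 1 - p + p exp (- t), the second derivative of ln D is q (1 - q) <= 1 / 4 for
q = p exp (- t) / D(t); the bound follows by integrating twice. *)
Lemma bernoulli_mgf_le (p l : R) : 0 <= p <= 1 -> 0 <= l ->
  1 - p * (1 - expR (- l)) <= expR (- (p * l) + l ^+ 2 / 8).
Proof.
move=> /andP[p0 p1] l0.
pose D : R -> R := cst (1 - p) + p \*: (expR \o -%R).
have DE t : D t = 1 - p + p * expR (- t) by [].
have D_gt0 t : 0 < D t.
  rewrite DE; have [->|pn1] := eqVneq p 1.
    by rewrite subrr add0r mul1r expR_gt0.
  apply: ltr_pwDl; last by rewrite mulr_ge0// expR_ge0.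
  by rewrite subr_gt0 lt_neqAle pn1.
have D0 : D 0 = 1 by rewrite DE oppr0 expR0; ring.
have dD (t : R) : is_derive t (1 : R) D (- (p * expR (- t))).
  have dE : is_derive t (1 : R) (expR \o -%R) (expR (- t) * -1).
    by apply: is_derive1_comp.
  apply: is_derive_eq (is_deriveD (is_derive_cst (1 - p) t (1 : R))
    (is_deriveZ p dE)) _.
  by rewrite add0r /GRing.scale /=; ring.
have odds t : 0 <= t -> (1 - p) * (D t)^-1 <= 1 - p + 1 / 4 * t.
  move=> t0.
  have dV (u : R) : is_derive u (1 : R) ((1 - p) \*: (fun y => (D y)^-1))
      ((1 - p) *: (- (D u) ^- 2 *: - (p * expR (- u)))).
    by apply: is_deriveZ; apply: is_deriveV; rewrite gt_eqF.
  have := @le_cubic_of_derive R _ _ (1 - p) (1 / 4) 0 0 dV.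
  rewrite /= D0 invr1 /GRing.scale /= mulr1 lexx => /(_ isT) h.
  have {h} := h _ t t0; rewrite !mul0r !addr0; apply=> u u0.
  rewrite !mulr0 !mul0r !addr0.
  have -> : (1 - p) * (- D u ^- 2 * - (p * expR (- u))) =
      ((1 - p) / D u) * (p * expR (- u) / D u) by field; rewrite gt_eqF.
  have : (1 - p) / D u + p * expR (- u) / D u = 1.
    by rewrite -mulrDl -DE mulfV// gt_eqF.
  set y := (1 - p) / D u; set z := p * expR (- u) / D u => yz.
  have := sqr_ge0 (y - z); have -> : y = 1 - z by rewrite -yz addrK.
  nra.
have dln (u : R) : is_derive u (1 : R) (@ln R \o D)
    ((D u)^-1 * - (p * expR (- u))).
  by apply: is_derive1_comp; apply: is_derive1_ln.
have := @le_cubic_of_derive R _ _ 0 (- p) (1 / 8) 0 dln.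
rewrite /= D0 ln1 lexx => /(_ isT) h.
have {h} lnD : ln (D l) <= 0 + - p * l + 1 / 8 * l ^+ 2 + 0 * l ^+ 3.
  apply: h => // u u0.
  have -> : (D u)^-1 * - (p * expR (- u)) = (1 - p) / D u - 1.
    have -> : - (p * expR (- u)) = 1 - p - D u by rewrite DE; ring.
    by rewrite mulrBr mulVf ?gt_eqF// mulrC.
  have := odds u u0; lra.
have -> : 1 - p * (1 - expR (- l)) = D l by rewrite DE; ring.
rewrite -[leLHS]lnK ?posrE// ler_expR (le_trans lnD)//.
by rewrite le_eqVlt; apply/orP; left; apply/eqP; field.
Qed.

End hoeffding.

Section tail_bound.
Context {R : realType} {d : measure_display} {Omega : measurableType d}.
Variable P : probability Omega R.
Implicit Types (A B : set Omega).

Let Pr A : R := fine (P A).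

Let PrE A : measurable A -> P A = (Pr A)%:E.
Proof. by move=> mA; rewrite fineK// fin_num_measure. Qed.

(** The integral over B of a version of the conditional probability is unchanged
when the version is replaced by its maximum with p, and is then at least
p P(B). *)
Lemma cond_prob_ge_le (G : set_system Omega) A B (p : R) : 0 <= p ->
  G `<=` measurable -> measurable A -> G B ->
  cond_prob_ge P G A p -> p * Pr B <= Pr (A `&` B).
Proof.
move=> p0 Gm mA GB [Y [Yad Yint YE] Yp].
have mB := Gm _ GB; have mAB := measurableI _ _ mA mB.
rewrite -lee_fin -(PrE _ mAB) EFinM -(PrE _ mB) -YE//.
have mY : measurable_fun setT Y.
  by move=> _ C mC; apply: Gm; apply: Yad; exists C.
have -> : (\int[P]_(w in B) (Y w)%:E = \int[P]_(w in B) (Num.max p (Y w))%:E)%E.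
  apply: ae_eq_integral => //.
  - by apply/measurable_EFinP; apply: measurable_funTS.
  - apply/measurable_EFinP; apply: measurable_funTS.
    by apply: measurable_maxr => //; exact: measurable_cst.
  - move: Yp; apply: filterS => w pY _.
    by rewrite max_r.
have -> : (p%:E * P B = \int[P]_(w in B) p%:E)%E by rewrite integral_cst.
apply: ge0_le_integral => //.
- apply/measurable_EFinP; apply: measurable_funTS.
  by apply: measurable_maxr => //; exact: measurable_cst.
- by move=> w _; rewrite lee_fin le_max lexx.
Qed.

(** Chernoff's bound for a sequence of events each of which has conditional
probability at least p given the past, by induction on the number of remaining
events: B is any event of the past, and splitting it according to the next event
multiplies the bound by at most 1 - p (1 - exp (- l)). *)
Lemma adapted_count_tail (F : nat -> set_system Omega) (A : nat -> set Omega)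
    (p l : R) (m k : nat) (b : R) B :
  0 <= l -> p <= 1 ->
  (forall k, F k `<=` measurable) ->
  (forall k B, F k B -> F k.+1 (B `&` A k) /\ F k.+1 (B `\` A k)) ->
  (forall k B, F k B -> p * Pr B <= Pr (B `&` A k)) ->
  F k B ->
  let X := B `&` [set w | (\sum_(k <= j < k + m) `[< A j w >])%N%:R <= b] in
  measurable X /\
  Pr X <= expR (l * b) * (1 - p * (1 - expR (- l))) ^+ m * Pr B.
Proof.
move=> l0 p1 Fm Fstep Fp; elim: m k b B => [|m IH] k b B FB /=.
  have s0 w : (\sum_(k <= j < k + 0) `[< A j w >] = 0)%N.
    by rewrite addn0 big_geq.
  rewrite expr0 mulr1; set X := (_ `&` _).
  have mB := Fm _ _ FB; have PB0 : 0 <= Pr B by rewrite fine_ge0.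
  have [b0|b0] := leP 0 b.
    have -> : X = B by rewrite /X; apply/seteqP; split=> w /= => [[]//|Bw]; rewrite s0.
    by split=> //; rewrite ler_peMl// -expR0 ler_expR mulr_ge0.
  have -> : X = set0.
    by rewrite /X; apply/seteqP; split=> w //= [_]; rewrite s0 leNgt b0.
  split; first exact: measurable0.
  by rewrite /Pr measure0 /= mulr_ge0// expR_ge0.
have [FBA FBD] := Fstep _ _ FB.
have [mX1 X1] := IH k.+1 (b - 1) _ FBA; have [mX2 X2] := IH k.+1 b _ FBD.
set X1s := (_ `&` _) in mX1 X1; set X2s := (_ `&` _) in mX2 X2.
have XE : B `&` [set w | (\sum_(k <= j < k + m.+1) `[< A j w >])%N%:R <= b] =
    X1s `|` X2s.
  have sumS w : (\sum_(k <= j < k + m.+1) `[< A j w >] =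
      `[< A k w >] + \sum_(k.+1 <= j < k.+1 + m) `[< A j w >])%N.
    by rewrite big_ltn ?addnS ?addSn// ltnS leq_addr.
  rewrite /X1s /X2s; apply/seteqP; split=> w /=.
    rewrite sumS natrD => -[Bw]; have [Aw|nAw] := asboolP (A k w) => h.
      by left; split=> //; rewrite lerBrDl.
    by right; split=> //; rewrite add0r in h.
  rewrite sumS natrD => -[[[Bw Aw] h]|[[Bw nAw] h]]; split=> //.
    by rewrite asboolT// -lerBrDl.
  by rewrite asboolF// add0r.
have dis : X1s `&` X2s = set0.
  by apply/seteqP; split=> w //= [[[_ Aw] _] [[_ nAw] _]].
rewrite XE; split; first exact: measurableU.
have -> : Pr (X1s `|` X2s) = Pr X1s + Pr X2s.
  by rewrite /Pr measureU// fineD// fin_num_measure.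
have mBA := Fm _ _ FBA; have mBD := Fm _ _ FBD.
have PB : Pr B = Pr (B `&` A k) + Pr (B `\` A k).
  rewrite -[in LHS](setUIDK B (A k)) /Pr measureU//.
    by rewrite fineD// fin_num_measure.
  by apply/seteqP; split=> w //= [[_ Aw] [_ nAw]].
set c := 1 - p * (1 - expR (- l)) in X1 X2 *.
have el : expR (- l) <= 1 by rewrite -expR0 ler_expR oppr_le0.
have c0 : 0 <= c.
  have e0 := expR_ge0 (- l).
  have : p * (1 - expR (- l)) <= 1 * (1 - expR (- l)).
    by rewrite ler_wpM2r// subr_ge0.
  rewrite /c; lra.
apply: le_trans (lerD X1 X2) _.
have -> : expR (l * (b - 1)) = expR (l * b) * expR (- l).
  by rewrite -expRD; congr expR; ring.
rewrite exprS; set E := expR (l * b) * c ^+ m.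
have -> : expR (l * b) * expR (- l) * c ^+ m * Pr (B `&` A k) +
    expR (l * b) * c ^+ m * Pr (B `\` A k) =
    E * (Pr B - (1 - expR (- l)) * Pr (B `&` A k)) by rewrite PB /E; ring.
have -> : expR (l * b) * (c * c ^+ m) * Pr B =
    E * (Pr B - (1 - expR (- l)) * (p * Pr B)) by rewrite /E /c; ring.
rewrite ler_wpM2l ?mulr_ge0 ?exprn_ge0 ?expR_ge0// lerD2l lerN2.
by rewrite ler_wpM2l ?subr_ge0// Fp.
Qed.

End tail_bound.

Section hoeffding_tail.
Context {R : realType} {d : measure_display} {Omega : measurableType d}.
Variable P : probability Omega R.

(** Optimising the Chernoff bound: the exponent l (p - q) - l ^ 2 / 8 is largest at
l = 4 (p - q), where it equals 2 (p - q) ^ 2. *)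
Lemma adapted_hoeffding (F : nat -> set_system Omega) (A : nat -> set Omega)
    (p q : R) (T : nat) :
  0 <= p <= 1 -> q <= p -> (forall k, F k setT) ->
  (forall k, F k `<=` measurable) ->
  (forall k B, F k B -> F k.+1 (B `&` A k) /\ F k.+1 (B `\` A k)) ->
  (forall k, cond_prob_ge P (F k) (A k) p) ->
  let X := [set w | (\sum_(k < T) `[< A k w >])%N%:R <= q * T%:R] in
  measurable X /\ fine (P X) <= expR (- (2 * (p - q) ^+ 2 * T%:R)).
Proof.
move=> p01 qp FT Fm Fstep Fp; have /andP[p0 p1] := p01.
have mA k : measurable (A k).
  by have [/Fm + _] := Fstep _ _ (FT k); rewrite setTI.
pose l := 4 * (p - q); have l0 : 0 <= l by rewrite mulr_ge0// subr_ge0.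
have Fpp k B : F k B -> p * fine (P B) <= fine (P (B `&` A k)).
  by move=> FB; rewrite setIC; exact: cond_prob_ge_le p0 (Fm k) (mA k) FB (Fp k).
have [] := @adapted_count_tail R d Omega P F A p l T 0 (q * T%:R) setT l0 p1
  Fm Fstep Fpp (FT 0%N).
rewrite setTI add0n => mX; set X1 := [set _ | _] in mX *; move=> PX X.
have XE : X = X1.
  by apply/seteqP; split=> w /=; rewrite /X /X1 /= big_mkord.
rewrite XE; split=> //; apply: le_trans PX _.
rewrite probability_setT /= mulr1.
have mgf := bernoulli_mgf_le p l p01 l0.
have mgf0 : 0 <= 1 - p * (1 - expR (- l)).
  have e0 := expR_ge0 (- l).
  have el : expR (- l) <= 1 by rewrite -expR0 ler_expR oppr_le0.
  have := mulr_ge0 (_ : 0 <= 1 - p) (_ : 0 <= 1 - expR (- l)).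
  rewrite !subr_ge0 => /(_ p1 el); nra.
have pw := lerXn2r T mgf0 (expR_ge0 _) mgf.
apply: le_trans (ler_wpM2l (expR_ge0 _) pw) _.
rewrite -expRM_natr -expRD ler_expR le_eqVlt; apply/orP; left; apply/eqP.
by rewrite /l; field.
Qed.

End hoeffding_tail.

(** * Measurable matrix-valued functions *)

Section measurable_matrices.
Context {R : realType} {d : measure_display} {T : measurableType d}.

Definition mx_measurable {m n : nat} (Y : T -> 'M[R]_(m, n)) : Prop :=
  forall i j, measurable_fun setT (fun w => Y w i j).

Lemma measurable_bool_set (f : T -> bool) :
  measurable_fun setT f -> measurable [set w | f w].
Proof.
by move=> mf; have := mf measurableT [set true]; rewrite setTI; apply.
Qed.

(** An open set of matrices is the union of the balls with rational centre and
radius that it contains. *)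
Lemma mx_measurable_open {m n : nat} (Y : T -> 'M[R]_(m, n))
    (U : set 'M[R]_(m, n)) :
  mx_measurable Y -> open U -> measurable (Y @^-1` U).
Proof.
move=> mY oU.
pose B (q : 'M[rat]_(m, n) * rat) : set 'M[R]_(m, n) :=
  [set A | forall i j, `|ratr (q.1 i j) - A i j| < ratr q.2].
have mB q : measurable (Y @^-1` B q).
  have -> : Y @^-1` B q = \bigcap_(ij in [set: 'I_m * 'I_n])
      [set w | `|ratr (q.1 ij.1 ij.2) - Y w ij.1 ij.2| < ratr q.2].
    by apply/seteqP; split=> w /= h => [[i j] _|i j]; [exact: h|exact: (h (i, j))].
  apply: fin_bigcap_measurable; first exact: finite_finset.
  move=> [i j] _ /=.
  have mf : measurable_fun setT
      (fun w => `|ratr (q.1 i j) - Y w i j| < ratr q.2 :> R).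
    apply: measurable_fun_ltr; last exact: measurable_cst.
    apply: measurableT_comp; first by apply: continuous_measurable_fun; exact: norm_continuous.
    by apply: measurable_funB => //; exact: mY.
  exact: measurable_bool_set mf.
pose F q := if `[< B q `<=` U >] then Y @^-1` B q else set0.
have -> : Y @^-1` U = \bigcup_q F q.
  apply/seteqP; split=> w /=; last first.
    by case=> q _; rewrite /F; case: asboolP => // BU /BU.
  move=> /(open_subball oU) [e /= e0 eU].
  have e20 : 0 < e / 2 by rewrite divr_gt0.
  have e40 : 0 < e / 2 / 2 by rewrite divr_gt0.
  have [r] := rat_in_itvoo e40.
  rewrite in_itv /= => /andP[r0 re].
  have near_rat i j : exists q : rat, `|ratr q - Y w i j| < ratr r.
    have lt_pm : Y w i j - ratr r < Y w i j + ratr r.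
      by rewrite ltrBlDr -addrA ltrDl addr_gt0.
    have [q] := rat_in_itvoo lt_pm.
    by rewrite in_itv /= => qr; exists q; rewrite ltr_distl.
  exists (\matrix_(i, j) sval (cid (near_rat i j)), r) => //; rewrite /F.
  rewrite asboolT.
    by move=> i j /=; rewrite mxE; exact: svalP (cid (near_rat i j)).
  move=> A BA; apply: (eU (e / 2)) => //=.
    by rewrite sub0r normrN gtr0_norm// ltr_pdivrMr// ltr_pMr// ltr1n.
  rewrite mx_norm_ball /ball_ /=.
  rewrite {1}/Num.norm /= mx_normrE; apply/bigmax_ltP; split=> // -[i j] _ /=.
  have := BA i j; rewrite /= mxE.
  have := svalP (cid (near_rat i j)); set q := sval _ => h1 h2.
  rewrite !mxE; apply: le_lt_trans (ler_distD (ratr q) _ _) _.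
  rewrite distrC [e / 2]splitr; apply: ltrD; first exact: lt_trans h1 re.
  exact: lt_trans h2 re.
apply: countable_bigcupT_measurable; first exact: countableP.
by move=> q; rewrite /F; case: ifP.
Qed.

Lemma mx_measurable_comp {m n : nat} (f : 'M[R]_(m, n) -> R)
    (Y : T -> 'M[R]_(m, n)) :
  continuous f -> mx_measurable Y -> measurable_fun setT (fun w => f (Y w)).
Proof.
move=> /continuousP cf mY; apply: (measurability _ (RGenOpens.measurableE R)).
move=> _ [_ [a [b ->] <-]]; rewrite setTI.
have oV : open (f @^-1` `]a, b[) by apply: cf; exact: interval_open.
by have := mx_measurable_open Y _ mY oV.
Qed.

Lemma measurable_dot {n : nat} (u v : T -> 'rV[R]_n) :
  mx_measurable u -> mx_measurable v ->
  measurable_fun setT (fun w => dot (u w) (v w)).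
Proof. by move=> mu mv; apply: measurable_sum => i; apply: measurable_funM. Qed.

Lemma mx_measurable_mulmx {m n p : nat} (A : T -> 'M[R]_(m, n))
    (B : T -> 'M[R]_(n, p)) :
  mx_measurable A -> mx_measurable B -> mx_measurable (fun w => A w *m B w).
Proof.
move=> mA mB i j; under eq_fun do rewrite mxE.
by apply: measurable_sum => k; apply: measurable_funM.
Qed.

Lemma mx_measurableD {m n : nat} (A B : T -> 'M[R]_(m, n)) :
  mx_measurable A -> mx_measurable B -> mx_measurable (fun w => A w + B w).
Proof.
by move=> mA mB i j; under eq_fun do rewrite mxE; exact: measurable_funD.
Qed.

Lemma mx_measurableB {m n : nat} (A B : T -> 'M[R]_(m, n)) :
  mx_measurable A -> mx_measurable B -> mx_measurable (fun w => A w - B w).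
Proof.
by move=> mA mB i j; under eq_fun do rewrite !mxE; exact: measurable_funB.
Qed.

Lemma measurable_enorm {n : nat} (u : T -> 'rV[R]_n) :
  mx_measurable u -> measurable_fun setT (fun w => enorm (u w)).
Proof.
apply: mx_measurable_comp; apply: lipschitz_entries_continuous => a b.
by apply: le_trans (enorm_leD a b) _; rewrite lerD2l big_ord1 enorm_le_sum.
Qed.

End measurable_matrices.

(** * Measurability of one iteration *)

Section measurable_step.
Context {R : realType} {n : nat} {d : measure_display} {T : measurableType d}.
Variables (c : params R) (phi : 'rV[R]_n -> R).
Hypothesis n_gt0 : (0 < n)%N.
Hypothesis c_ok : params_ok c.
Hypothesis phi_C2 : twice_continuously_differentiable phi.
Hypothesis phi_lip : lipschitz_hessian phi (L2 c).

Lemma mx_measurable_grad (x : T -> 'rV[R]_n) :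
  mx_measurable x -> mx_measurable (fun w => grad phi (x w)).
Proof.
have [_ dgrad _] := phi_C2; move=> mx i j.
apply: (mx_measurable_comp (fun y => grad phi y i j) x) => // y.
apply: (@continuous_comp _ _ _ (grad phi) (fun v : 'rV[R]_n => v i j)).
  exact: differentiable_continuous.
exact: coord_continuous.
Qed.

Lemma mx_measurable_hess (x : T -> 'rV[R]_n) :
  mx_measurable x -> mx_measurable (fun w => hess phi (x w)).
Proof.
have [_ _ chess] := phi_C2; move=> mx i j.
apply: (mx_measurable_comp (fun y => hess phi y i j) x) => // y.
apply: (@continuous_comp _ _ _ (hess phi) (fun v : 'M[R]_n => v i j)).
  exact: chess.
exact: coord_continuous.
Qed.

(** On symmetric matrices the least eigenvalue agrees with a continuous function on
all matrices. *)
Lemma measurable_lambda_min (H : T -> 'M[R]_n) :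
  (forall w, (H w)^T = H w) -> mx_measurable H ->
  measurable_fun setT (fun w => lambda_min (H w)).
Proof.
move=> symH mH; under eq_fun do rewrite lambda_minE//.
by apply: mx_measurable_comp => //; exact: continuous_rayleigh.
Qed.

(** This is where the symmetry of the exact Hessian matters: lambda_min of the
Hessian is then a continuous function of the point. *)
Lemma measurable_optimality (x : T -> 'rV[R]_n) :
  mx_measurable x -> measurable_fun setT (fun w => optimality c phi (x w)).
Proof.
move=> mx; apply: measurable_maxr; apply: measurable_funB => //.
  apply: measurable_funM => //.
  by apply: measurable_enorm; exact: mx_measurable_grad.
apply: measurable_funM => //; apply: measurable_lambda_min.
  by move=> w; exact: (hess_sym phi (L2 c)).
exact: mx_measurable_hess.
Qed.

Variables (delta : T -> R) (x g s : T -> 'rV[R]_n) (H : T -> 'M[R]_n).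
Variables (f fplus : T -> R).
Hypothesis m_delta : measurable_fun setT delta.
Hypothesis m_x : mx_measurable x.
Hypothesis m_g : mx_measurable g.
Hypothesis m_H : mx_measurable H.

Lemma measurable_first_order_accurate :
  measurable [set w | first_order_accurate c phi (delta w ^+ 2) (x w) (g w)].
Proof.
apply: measurable_bool_set; apply: measurable_fun_ler.
  by apply: measurable_enorm; apply: mx_measurableB => //; exact: mx_measurable_grad.
apply: measurable_funD => //; apply: measurable_funM => //.
exact: measurable_funX.
Qed.

Lemma measurable_second_order_accurate :
  measurable [set w | second_order_accurate c phi (delta w) (x w) (H w)].
Proof.
apply: measurable_bool_set; apply: measurable_fun_ler.
  apply: mx_measurable_comp; first exact: continuous_specnorm.
  by apply: mx_measurableB => //; exact: mx_measurable_hess.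
by apply: measurable_funD => //; apply: measurable_funM.
Qed.

Hypothesis H_sym : forall w, (H w)^T = H w.
Hypothesis H_bounded : forall w, specnorm (H w) <= kappa_bhm c.
Hypothesis s_ok : forall w, sufficient_step c phi (delta w) (x w) (g w) (H w) (s w).
Hypothesis delta_gt0 : forall w, 0 < delta w.
Hypothesis m_s : mx_measurable s.
Hypothesis m_f : measurable_fun setT f.
Hypothesis m_fplus : measurable_fun setT fplus.

(** The model decrease being nonnegative, the acceptance test can be stated without
the quotient rho, by polynomial inequalities. *)
Lemma measurable_accept : measurable_fun setT
  (fun w => accept c phi (x w) (g w) (H w) (s w) (f w) (fplus w)).
Proof.
pose dec w := - dot (g w) (s w) - 1 / 2 * dot (s w *m H w) (s w).
have decE w : model_decrease phi (x w) (g w) (H w) (s w) = dec w.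
  exact: model_decreaseE.
have dec_ge0 w : 0 <= dec w.
  by rewrite -decE; exact: decrease_ge0 (delta_gt0 w) (H_bounded w) (s_ok w).
have -> : (fun w => accept c phi (x w) (g w) (H w) (s w) (f w) (fplus w)) =
    (fun w => (0 < dec w) && (eta1 c * dec w <= f w - fplus w + r c)).
  apply/funext => w; rewrite /accept /rho decE lt_neqAle dec_ge0 andbT eq_sym.
  case: eqVneq => //= dn0; rewrite ler_pdivlMr//.
  by rewrite lt_neqAle dn0 dec_ge0.
have mdec : measurable_fun setT dec.
  apply: measurable_funB; first by apply: measurable_funN; exact: measurable_dot.
  apply: measurable_funM => //; apply: measurable_dot => //.
  exact: mx_measurable_mulmx.
apply: measurable_and; first exact: measurable_fun_ltr.
apply: measurable_fun_ler; first exact: measurable_funM.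
by apply: measurable_funD => //; exact: measurable_funB.
Qed.

Lemma mx_measurable_next_iterate : mx_measurable
  (fun w => next_iterate c phi (x w) (g w) (H w) (s w) (f w) (fplus w)).
Proof.
move=> i j.
have -> : (fun w => next_iterate c phi (x w) (g w) (H w) (s w) (f w) (fplus w) i j)
  = (fun w => if accept c phi (x w) (g w) (H w) (s w) (f w) (fplus w)
              then (x w + s w) i j else x w i j).
  by apply/funext => w; rewrite /next_iterate; case: ifP.
apply: measurable_fun_ifT; first exact: measurable_accept.
  exact: mx_measurableD.
exact: m_x.
Qed.

Lemma measurable_next_radius : measurable_fun setT
  (fun w => next_radius c phi (delta w) (x w) (g w) (H w) (s w) (f w) (fplus w)).
Proof.
apply: measurable_fun_ifT; last 2 first.
- exact: measurable_funM.
- exact: measurable_funM.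
apply: measurable_and; first exact: measurable_accept.
apply: measurable_fun_ler; first exact: measurable_funM.
apply: measurable_maxr; first exact: measurable_enorm.
by apply: measurable_funN; exact: measurable_lambda_min.
Qed.

End measurable_step.

Section filtration.
Context {R : realType} {d : measure_display} {Omega : measurableType d}.

(** Adaptedness is measurability on the space of outcomes equipped with the smaller
sigma-algebra, so that the lemmas on measurable functions apply to it. *)
Lemma adaptedP (C : set_system Omega) {d'} {E : measurableType d'}
    (Y : Omega -> E) :
  adapted <<s C >> Y <->
  measurable_fun [set: g_sigma_algebraType C] (Y : g_sigma_algebraType C -> E).
Proof.
split=> [aY _ B mB|mY _ [B mB <-]]; first by apply: aY; exists B.
exact: mY.
Qed.

Lemma mx_adaptedP (C : set_system Omega) {m n : nat}
    (Y : Omega -> 'M[R]_(m, n)) :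
  mx_adapted <<s C >> Y <->
  @mx_measurable R _ (g_sigma_algebraType C) m n Y.
Proof. by split=> h i j; apply/adaptedP; exact: h. Qed.

End filtration.

(** * The stochastic run *)

Section run.
Context {R : realType} {n : nat}.
Variables (c : params R) (phi : 'rV[R]_n -> R).
Hypothesis n_gt0 : (0 < n)%N.
Hypothesis c_ok : params_ok c.
Hypothesis phi_C2 : twice_continuously_differentiable phi.
Hypothesis phi_lip : lipschitz_hessian phi (L2 c).
Hypothesis r_lower : 2 * eps_f c + eps_g c `^ (3 / 2) <= r c.
Context {d d0 d1 d2 : measure_display} {Omega : measurableType d}.
Context {E0 : measurableType d0} {E1 : measurableType d1}
  {E2 : measurableType d2}.
Variables (xi0 xi0t : nat -> Omega -> E0) (xi1 : nat -> Omega -> E1)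
  (xi2 : nat -> Omega -> E2).
Hypothesis xi0_meas : forall k, measurable_fun setT (xi0 k).
Hypothesis xi0t_meas : forall k, measurable_fun setT (xi0t k).
Hypothesis xi1_meas : forall k, measurable_fun setT (xi1 k).
Hypothesis xi2_meas : forall k, measurable_fun setT (xi2 k).
Variables (o0 : 'rV[R]_n -> E0 -> R)
  (o1 : R -> R -> 'rV[R]_n -> E1 -> 'rV[R]_n)
  (o2 : R -> R -> 'rV[R]_n -> E2 -> 'M[R]_n).
Hypothesis o0_noise : bounded_noise c phi o0.
Hypothesis o2_sym : forall delta p x e, (o2 delta p x e)^T = o2 delta p x e.
Variables (x0 : 'rV[R]_n) (delta0 : R).
Hypothesis delta0_gt0 : 0 < delta0.
Variable S : process R n Omega.
Hypothesis S_run : is_run xi0 xi0t xi1 xi2 c phi o0 o1 o2 x0 delta0 S.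
Hypothesis S_adapted : is_adapted xi0 xi0t xi1 xi2 S.
Hypothesis hess_bounded : forall k w, specnorm (hess_ S k w) <= kappa_bhm c.

Let hist := history xi0 xi0t xi1 xi2.

Lemma radius_gt0 k w : 0 < radius_ S k w.
Proof.
have /andP[g0 _] := gamma_bnd c_ok.
elim: k => [|k IH]; first by rewrite (run_radius0 S_run).
rewrite (run_radius S_run) /next_radius.
by case: ifP => _; rewrite mulr_gt0// invr_gt0.
Qed.

Lemma hess_estimate_sym k w : (hess_ S k w)^T = hess_ S k w.
Proof. by rewrite (run_hess S_run) o2_sym. Qed.

Lemma history_measurable k : hist k `<=` measurable.
Proof.
apply: smallest_sub; first exact: sigma_algebra_measurable.
by move=> B [j _] [[[|]|]|] [C mC <-]; [exact: xi0_meas|exact: xi0t_meas|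
  exact: xi1_meas|exact: xi2_meas].
Qed.

Lemma history_sub k : hist k `<=` hist k.+1.
Proof.
apply: sub_sigma_algebra2; apply: bigcup_subset => j /=.
exact: ltnW.
Qed.

Lemma adapted_sub {d'} {E : measurableType d'} k (Y : Omega -> E) :
  adapted (hist k) Y -> adapted (hist k.+1) Y.
Proof. by move=> aY B /aY; exact: history_sub. Qed.

(** The radius and the iterate of iteration k.+1 are measurable functions of those
of iteration k and of the answers of the oracles in iteration k. *)
Lemma iterate_adapted k :
  mx_adapted (hist k) (iter_ S k) /\ adapted (hist k) (radius_ S k).
Proof.
elim: k => [|k [ax ad]].
  split=> [i j|].
    rewrite (_ : (fun w => _) = cst (x0 i j)).
      by apply/adaptedP; exact: measurable_cst.
    by apply/funext => w; rewrite (run_iter0 S_run).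
  by apply/adaptedP; rewrite (funext (run_radius0 S_run)); exact: measurable_cst.
have mx := (mx_adaptedP _ _).1 (fun i j => adapted_sub _ _ (ax i j)).
have md := (adaptedP _ _).1 (adapted_sub _ _ ad).
have mg := (mx_adaptedP _ _).1 (adapted_grad S_adapted (k:=k)).
have mH := (mx_adaptedP _ _).1 (adapted_hess S_adapted (k:=k)).
have ms := (mx_adaptedP _ _).1 (adapted_step S_adapted (k:=k)).
have mf := (adaptedP _ _).1 (adapted_fval S_adapted (k:=k)).
have mf' := (adaptedP _ _).1 (adapted_ftrial S_adapted (k:=k)).
have sym := hess_estimate_sym k; have stepk := run_step S_run k.
have dk := radius_gt0 k; have Hk := hess_bounded k.
split.
  apply/mx_adaptedP; rewrite (funext (run_iter S_run k)).
  exact: (@mx_measurable_next_iterate _ _ _ (g_sigma_algebraType _) c phi c_ok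
    (radius_ S k)).
apply/adaptedP; rewrite (funext (run_radius S_run k)).
exact: measurable_next_radius.
Qed.

Definition true_event k : set Omega :=
  grad_event c phi S k `&` hess_event c phi S k.

Lemma true_event_adapted k : hist k.+1 (true_event k).
Proof.
have [ax ad] := iterate_adapted k.
have mx := (mx_adaptedP _ _).1 (fun i j => adapted_sub _ _ (ax i j)).
have md := (adaptedP _ _).1 (adapted_sub _ _ ad).
have mg := (mx_adaptedP _ _).1 (adapted_grad S_adapted (k:=k)).
have mH := (mx_adaptedP _ _).1 (adapted_hess S_adapted (k:=k)).
apply: (@measurableI _ (g_sigma_algebraType _)).
  exact: measurable_first_order_accurate.
exact: measurable_second_order_accurate.
Qed.

Lemma measurable_optimality_iter k :
  measurable_fun setT (fun w => optimality c phi (iter_ S k w)).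
Proof.
have [ax _] := iterate_adapted k.
apply: (measurable_optimality c phi n_gt0 phi_C2 phi_lip) => i j _ B mB.
by apply: (history_measurable k); apply: ax; exists B.
Qed.

Lemma C8_gt0 : 0 < C8 c.
Proof.
have /andP[h0 _] := eta1_bnd c_ok; have h2 := eta2_gt0 c_ok.
have /andP[k0 _] := kappa_fod_bnd c_ok; have kb := kappa_bhm_gt0 c_ok.
by rewrite /C8 mulr_gt0 ?mulr_gt0 ?invr_gt0// lt_min divr_gt0/=.
Qed.

(** When eps < b the two arguments of the minimum are eps / delta0 and a number
below delta0 / eps, so its logarithm bounds both log (eps / delta0) and its
opposite: it covers the way from delta0 to eps in either direction. *)
Lemma radius_ratio_ge (eps b : R) : 0 < eps -> eps < b ->
  `|logb (gamma c) (eps / delta0)| <= logb (gamma c) (radius_ratio eps delta0 b).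
Proof.
move=> eps0 epsb; have b0 : 0 < b by exact: lt_trans epsb.
have /andP[g0 g1] := gamma_bnd c_ok.
have lg : ln (gamma c) < 0 by rewrite ln_lt0// g0.
have logb_anti u v : 0 < u -> u <= v -> logb (gamma c) v <= logb (gamma c) u.
  move=> u0 uv; rewrite /logb ler_wnM2r ?invr_le0 ?(ltW lg)//.
  by rewrite ler_ln ?posrE// (lt_le_trans u0).
rewrite /radius_ratio [b <= 0]leNgt b0 /=.
have min0 : 0 < Num.min (eps / delta0) (delta0 / b) by rewrite lt_min !divr_gt0.
rewrite ler_norml lerNl; apply/andP; split; last first.
  by apply: logb_anti => //; rewrite ge_min lexx.
have -> : - logb (gamma c) (eps / delta0) = logb (gamma c) (delta0 / eps).
  by rewrite /logb -mulNr -lnV ?posrE ?divr_gt0// invf_div.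
apply: logb_anti => //; rewrite ge_min; apply/orP; right.
by rewrite ler_wpM2l ?(ltW delta0_gt0)// lef_pV2 ?posrE// ltW.
Qed.

(** As long as the optimality measure stays above eps, every true iteration with
radius at most eps increases the radius, so the counting argument applies with
the threshold eps. *)
Lemma true_iterations_le (phi_low eps phat : R) (T : nat) w :
  (forall x, phi_low <= phi x) -> 0 < eps -> eps <= 1 ->
  let h := C8 c * (gamma c * eps) ^+ 3 in
  0 < phat - 1 / 2 - (2 * eps_f c + r c) / h ->
  (phat - 1 / 2 - (2 * eps_f c + r c) / h)^-1
    * ((phi x0 - phi_low) / h
       + 1 / 2 * logb (gamma c) (radius_ratio eps delta0 (optimality c phi x0))
       + 1 / 2) <= T%:R ->
  (0 < T)%N -> (forall k, (k < T)%N -> eps < optimality c phi (iter_ S k w)) ->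
  (\sum_(k < T) `[< true_event k w >])%N%:R <= phat * T%:R.
Proof.
move=> phi_bounded eps0 eps1 h q0 T_ge T0 big_beta.
have /andP[g0 g1] := gamma_bnd c_ok.
have ge0 : 0 < gamma c * eps by rewrite mulr_gt0.
have f_noise k : `|fval_ S k w - phi (iter_ S k w)| <= eps_f c.
  by rewrite (run_fval S_run); exact: o0_noise.
have ft_noise k :
    `|ftrial_ S k w - phi (iter_ S k w + step_ S k w)| <= eps_f c.
  by rewrite (run_ftrial S_run); exact: o0_noise.
pose acc k := accept c phi (iter_ S k w) (grad_ S k w) (hess_ S k w)
  (step_ S k w) (fval_ S k w) (ftrial_ S k w).
pose up k := acc k &&
  (eta2 c * radius_ S k w <= beta_model (grad_ S k w) (hess_ S k w)).
apply: (@count_true_iterations R T (fun k => radius_ S k w)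
  (fun k => phi (iter_ S k w)) up (fun k => `[< true_event k w >])
  (gamma c) eps h (2 * eps_f c + r c) phi_low
  (logb (gamma c) (radius_ratio eps delta0 (optimality c phi x0))) phat _ _ _ _ _ _ _ _ _ _ q0).
- by rewrite g0.
- exact: eps0.
- exact: radius_gt0.
- by rewrite mulr_gt0 ?C8_gt0// exprn_gt0.
- by move=> k; rewrite (run_radius S_run).
- move=> k kT /asboolP[gacc hacc] small.
  apply: (true_small_successful c phi n_gt0 c_ok phi_C2 phi_lip r_lower) => //.
  + exact: radius_gt0.
  + exact: hess_estimate_sym.
  + exact: (run_step S_run).
  + exact: le_trans small eps1.
  + exact: le_trans small (ltW (big_beta k kT)).
- move=> k; rewrite (run_iter S_run).
  apply: (next_iterate_phi c phi c_ok (radius_ S k w) _ _ _ _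
    (fval_ S k w) (ftrial_ S k w)) => //.
  + exact: radius_gt0.
  + exact: (run_step S_run).
- move=> k /andP[ak bk] large; rewrite (run_iter S_run) /next_iterate.
  rewrite -/(acc k) ak; apply: (successful_decrease c phi c_ok (radius_ S k w) _ _ _ _
    (fval_ S k w) (ftrial_ S k w)) => //.
  + exact: radius_gt0.
  + exact: (run_step S_run).
  + exact: ltW.
  + by rewrite mulr_ile1// ltW.
  + exact: ak.
  + exact: bk.
- by move=> k; exact: phi_bounded.
- have := big_beta 0%N T0; rewrite (run_iter0 S_run) (run_radius0 S_run) => b0.
  exact: radius_ratio_ge.
- by rewrite (run_iter0 S_run).
Qed.

End run.

Theorem theorem5p7 (R : realType) (n : nat) (n_gt0 : (0 < n)%N)
  (c : params R) (c_ok : params_ok c)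
  (phi : 'rV[R]_n -> R) (phi_low : R)
  (phi_C2 : twice_continuously_differentiable phi)
  (phi_lip : lipschitz_hessian phi (L2 c))
  (phi_bounded : forall x, phi_low <= phi x)
  (r_lower : 2 * eps_f c + eps_g c `^ (3 / 2) <= r c)
  (d d0 d1 d2 : measure_display)
  (Omega : measurableType d) (P : probability Omega R)
  (E0 : measurableType d0) (E1 : measurableType d1) (E2 : measurableType d2)
  (xi0 xi0t : nat -> Omega -> E0) (xi1 : nat -> Omega -> E1)
  (xi2 : nat -> Omega -> E2)
  (xi0_meas : forall k, measurable_fun setT (xi0 k))
  (xi0t_meas : forall k, measurable_fun setT (xi0t k))
  (xi1_meas : forall k, measurable_fun setT (xi1 k))
  (xi2_meas : forall k, measurable_fun setT (xi2 k))
  (o0 : 'rV[R]_n -> E0 -> R)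
  (o1 : R -> R -> 'rV[R]_n -> E1 -> 'rV[R]_n)
  (o2 : R -> R -> 'rV[R]_n -> E2 -> 'M[R]_n)
  (o0_noise : bounded_noise c phi o0)
  (o2_sym : forall delta p x e, (o2 delta p x e)^T = o2 delta p x e)
  (x0 : 'rV[R]_n) (delta0 : R) (delta0_gt0 : 0 < delta0)
  (S : process R n Omega)
  (S_run : is_run xi0 xi0t xi1 xi2 c phi o0 o1 o2 x0 delta0 S)
  (S_adapted : is_adapted xi0 xi0t xi1 xi2 S)
  (S_reliable : conditionally_reliable xi0 xi0t xi1 xi2 c phi S P)
  (hess_bounded : forall k w, specnorm (hess_ S k w) <= kappa_bhm c)
  (p12_gt : 1 / 2 < p12 c)
  (eps : R)
  (eps_lower :
    ((4 * eps_f c + 2 * r c) / (C8 c * gamma c ^+ 3 * (2 * p12 c - 1)))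
      `^ (1 / 3) < eps)
  (eps_le1 : eps <= 1)
  (phat : R)
  (phat_lower :
    1 / 2 + (2 * eps_f c + r c) / (C8 c * (gamma c * eps) ^+ 3) < phat)
  (phat_upper : phat <= p12 c)
  (T : nat) (T_gt0 : (0 < T)%N)
  (T_lower :
    (phat - 1 / 2 - (2 * eps_f c + r c) / (C8 c * (gamma c * eps) ^+ 3))^-1
      * ((phi x0 - phi_low) / (C8 c * (gamma c * eps) ^+ 3)
         + 1 / 2 * logb (gamma c) (radius_ratio eps delta0 (optimality c phi x0))
         + 1 / 2)
      <= T%:R) :
  ((1 - expR (- ((1 - phat / p12 c) ^+ 2 / 2 * T%:R)))%:E
   <= P [set w | \big[Num.min/optimality c phi (iter_ S 0 w)]_(k < T)
                   optimality c phi (iter_ S k w) <= eps]%R)%E.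
Proof.
have /andP[p1_0 p1_1] := p1_bnd c_ok; have /andP[p2_0 p2_1] := p2_bnd c_ok.
have p12_0 : 0 < p12 c by apply: lt_trans p12_gt; rewrite divr_gt0.
have p12_1 : p12 c <= 1 by rewrite /p12 mulr_ile1//; lra.
have eps0 : 0 < eps by apply: le_lt_trans eps_lower; exact: powR_ge0.
pose hist := history xi0 xi0t xi1 xi2; pose A := true_event c phi S.
have hist_meas k : hist k `<=` measurable by exact: history_measurable.
have histT k : hist k setT.
  exact: (@measurableT _ (g_sigma_algebraType _)).
have A_adapted k : hist k.+1 (A k).
  exact: (true_event_adapted c phi n_gt0 c_ok phi_C2 xi0 xi0t xi1 xi2 o0 o1 o2
    o2_sym x0 delta0 delta0_gt0 S S_run S_adapted hess_bounded).
have histI k B : hist k B -> hist k.+1 (B `&` A k) /\ hist k.+1 (B `\` A k).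
  move=> hB0; have hB := history_sub xi0 xi0t xi1 xi2 k B hB0; split.
    exact: (@measurableI _ (g_sigma_algebraType _) _ _ hB (A_adapted k)).
  exact: (@measurableD _ (g_sigma_algebraType _) _ _ hB (A_adapted k)).
have [mX PX] := adapted_hoeffding P hist A (p12 c) phat T
  (introT andP (conj (ltW p12_0) p12_1)) phat_upper histT hist_meas histI
  (reliable_joint S_reliable).
set X := [set w | _] in mX PX; set good := [set w | _].
have goodE : ~` good = \bigcap_(k in `I_T)
    [set w | eps < optimality c phi (iter_ S k w)].
  apply/seteqP; split=> w /=.
    move=> /negP; rewrite -ltNge => /bigmin_gtP[_ h] k kT.
    exact: (h (Ordinal kT)).
  move=> h; apply/negP; rewrite -ltNge; apply/bigmin_gtP; split.
    exact: (h 0%N T_gt0).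
  by move=> [k kT] _; exact: (h k kT).
have m_bad : measurable (~` good).
  rewrite goodE; apply: bigcap_measurable; first by exists 0%N.
  move=> k _; apply: measurable_bool_set; apply: measurable_fun_ltr => //.
  exact: (measurable_optimality_iter c phi n_gt0 c_ok phi_C2 phi_lip xi0 xi0t
    xi1 xi2 xi0_meas xi0t_meas xi1_meas xi2_meas o0 o1 o2 o2_sym x0 delta0
    delta0_gt0 S S_run S_adapted hess_bounded).
have m_good : measurable good by rewrite -[good]setCK; exact: measurableC.
have bad_X : ~` good `<=` X.
  rewrite goodE => w big; apply: (true_iterations_le c phi n_gt0 c_ok phi_C2 phi_lip
    r_lower xi0 xi0t xi1 xi2 o0 o1 o2 o0_noise o2_sym x0 delta0 delta0_gt0 S S_run
    hess_bounded phi_low eps) => //.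
  by rewrite subr_gt0 ltrBrDr addrC.
have -> : P good = (1 - P (~` good))%E.
  by rewrite -probability_setC// setCK.
have Pbad : (P (~` good) <= (expR (- ((1 - phat / p12 c) ^+ 2 / 2 * T%:R)))%:E)%E.
  apply: (@le_trans _ _ (P X)); first by apply: le_measure; rewrite ?inE.
  rewrite -[P X]fineK ?fin_num_measure// lee_fin (le_trans PX)//.
  rewrite ler_expR lerN2 ler_wpM2r//.
  have -> : 1 - phat / p12 c = (p12 c - phat) / p12 c.
    by rewrite mulrBl mulfV ?gt_eqF.
  rewrite expr_div_n ler_pdivrMr// ler_pdivrMr ?exprn_gt0//.
  (* Since p12 > 1 / 2, the factor 2 (p12 - phat) ^ 2 is at least
     (p12 - phat) ^ 2 / (2 p12 ^ 2). *)
  have sq : 0 <= (p12 c - phat) ^+ 2 by exact: sqr_ge0.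
  have : 1 <= 4 * p12 c ^+ 2 by nra.
  nra.
rewrite EFinB leeB//.
Qed.
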